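(* Let $d,e\in\mathcal{G}$, $h\in\mathcal{P}_{\mathcal{H}}$, $\eta\in\mathcal{H}^*$, and put $\delta=\gamma(d)$, $\epsilon=\gamma(e)$. Then $\xi=\xi_\gamma\xi_g$ operates by conjugation ($y\mapsto\xi^{-1}y\xi$) on $Q_x$ as follows: \begin{align*} \tilde x_d\,\tilde x_h\,x_\epsilon\,x_\eta&\ \stackrel{\xi}{\longmapsto}\ (-1)^{w_2(e)+\langle\!\langle d,e\rangle\!\rangle}\,\tilde x_e\,\tilde x_h\,x_{\delta+\epsilon}\,x_\eta,\\ \tilde x_d\,\tilde x_h\,x_\epsilon\,x_\eta&\ \stackrel{\xi^2}{\longmapsto}\ (-1)^{w_2(d)+\langle\!\langle d,e\rangle\!\rangle}\,\tilde x_{d+e}\,\tilde x_h\,x_{\delta}\,x_\eta,\\ x_h\,x_{\gamma(h)}&\ \stackrel{\xi}{\longmapsto}\ x_h\,x_{\gamma(h)}. \end{align*} Here $(-1)^k$ denotes the central element $x_{-1}^k$ of $Q_x$.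
   Context: Golay code. Let $\mathbb{F}_4=\{0,1,\alpha,\bar\alpha\}$, $\alpha^2=\bar\alpha=1+\alpha$, and let $\mathcal{H}_6\subset\mathbb{F}_4^6$ be the $\mathbb{F}_4$-span of $(1,0,0,1,\bar\alpha,\alpha),(0,1,0,1,\alpha,\bar\alpha),(0,0,1,1,1,1)$. Let $\tilde\Omega=\{0,\dots,23\}$, arranged in an array (MOG) with rows $0,\dots,3$ and columns $0,\dots,5$, the element $m+4n$ being in row $m$, column $n$; rows $0,1,2,3$ carry labels $0,1,\alpha,\bar\alpha$. Subsets of $\tilde\Omega$ are identified with vectors in $\mathbb{F}_2^{24}$. For $x\in\mathbb{F}_2^{24}$, $\mathfrak h(x)\in\mathbb{F}_4^6$ has $n$-th coordinate the sum of the labels of the rows in which $x$ has an entry $1$ in column $n$. $\mathcal{C}$ is the set of $x$ with $\mathfrak h(x)\in\mathcal{H}_6$ such that the parity of $x$ in every column equals its parity in row $0$; it is a Golay code. $\mathcal{C}^*=\mathbb{F}_2^{24}/\mathcal{C}$, with pairing $\langle d,\delta\rangle=|d\cap\delta|\bmod 2$ on $\mathcal{C}\times\mathcal{C}^*$; subsets of $\tilde\Omega$ also denote their classes in $\mathcal{C}^*$. Grey and coloured parts. $\mathcal{G}\subset\mathcal{C}$: code words whose entries in rows 1,2,3 agree in each column. $\mathcal{H}\subset\mathcal{C}$: code words with zeros in row 0 and $0$ or $2$ ones in each column. $\mathcal{C}=\mathcal{G}\oplus\mathcal{H}$. $\mathcal{G}^*,\mathcal{H}^*\subset\mathcal{C}^*$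 are the orthogonal complements of $\mathcal{H}$, $\mathcal{G}$. $\mathcal{G}$ has basis $g_0,\dots,g_5$, where $g_i$ has ones exactly in rows 1,2,3 of column $i$ and in row 0 of the columns $\ne i$. $\mathcal{G}^*$ has basis $\gamma_0,\dots,\gamma_5$, with $\gamma_i$ the class of the element in row 0, column $i$. $\omega=\sum_i\gamma_i$. $w$ is the weight (number of nonzero coefficients) with respect to these bases on $\mathcal{G}$ resp. $\mathcal{G}^*$, and $w_2=\binom{w}{2}\bmod 2$. $\gamma:\mathcal{C}\to\mathcal{G}^*$, $\gamma(d)$ = sum of those $\gamma_i$ for which $d$ has at least two ones in rows 1,2,3 of column $i$. For $d,e\in\mathcal{G}$, $\langle\!\langle d,e\rangle\!\rangle=\langle d,\gamma(e)\rangle=\langle e,\gamma(d)\rangle$. Parker loop. $P(d)=\frac14|d|$, $C(d,e)=\frac12|d\cap e|$, $A(d,e,f)=|d\cap e\cap f|$ (mod 2); $A(d,e)\in\mathcal{C}^*$ is the class of $d\cap e$. Fix $\theta:\mathcal{C}\times\mathcal{C}\to\mathbb{F}_2$ with $\theta(d,d)=P(d)$, $\theta(d,e)+\theta(e,d)=C(d,e)$, $\theta(d+e,f)=\theta(d,f)+\theta(e,f)+A(d,e,f)$, $\theta(d,e+f)=\theta(d,e)+\theta(d,f)$; let $\theta(d)\in\mathcal{C}^*$ be given by $\langle e,\theta(d)\rangle=\theta(d,e)$. Moreover $\theta(d+\tilde\Omega)=\theta(d)$ for $d\in\mathcal{C}$; $\theta(e)=(w(e)-1)\gamma(e)+w_2(e)\omega$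 for $e\in\mathcal{G}$; $\theta(e,h)=0$ and $\theta(h,e)=\langle e,\gamma(h)\rangle$ for $e\in\mathcal{G},h\in\mathcal{H}$. The Parker loop is $\mathcal{P}=\mathcal{C}\times\mathbb{F}_2$ with $(d,\lambda)(e,\mu)=(d+e,\lambda+\mu+\theta(d,e))$; $-1=(0,1)$. $\mathcal{P}_{\mathcal{H}}$ is the preimage of $\mathcal{H}$ under the projection $\mathcal{P}\to\mathcal{C}$. Functions on $\mathcal{C}$ are applied to $\mathcal{P}$ via projection. $Q_x$. $Q_x$ is the group of order $2^{25}$ generated by $x_d$ ($d\in\mathcal{P}$), $x_\delta$ ($\delta\in\mathcal{C}^*$) with $x=x_{-1}$ central and defining relations $x_d^2=x^{P(d)}$, $x_\delta^2=1$, $x_dx_e=x_{de}x_{A(d,e)}$, $x_\delta x_\epsilon=x_{\delta+\epsilon}$, $[x_d,x_\delta]=x^{\langle d,\delta\rangle}$. It is extraspecial of type $2_+^{1+24}$ with center $\{1,x_{-1}\}$. Put $\tilde x_d=x_{(d,0)}x_{\theta(d)}$ for $d\in\mathcal{C}$, and for $d\in\mathcal{P}$ let $\tilde x_d$ be $\tilde x$ of the projection of $d$ to $\mathcal{C}$. $\mathbb{R}Q_x^\pm$ is the quotient of the group ring $\mathbb{R}Q_x$ obtained by identifying $x_{-1}$ with the scalar $-1$; $Q_x$ embeds in it. In $\mathbb{R}Q_x^\pm$ put $$\xi_\gamma=\tfrac18\sum_{\epsilon\in\mathcal{G}^*}(-1)^{w_2(\epsilon)}x_\epsilon,\quad \xi_g=\tfrac18\sum_{e\in\mathcal{G}}(-1)^{w_2(e)}\tilde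 x_e,\quad \xi=\xi_\gamma\xi_g .$$ *)

(* Defs.v *)
From HB Require Import structures.
From mathcomp Require Import all_boot all_order all_algebra all_fingroup.
From mathcomp Require Import boolp reals.

Set Implicit Arguments.
Unset Strict Implicit.
Unset Printing Implicit Defensive.

Import GRing.Theory.
Local Open Scope ring_scope.
Local Open Scope quotient_scope.

(* The field F_4: the pair (a, b) of bits stands for a + b alpha, where
   alpha ^ 2 = 1 + alpha. *)
Definition F4 : Type := (bool * bool)%type.
HB.instance Definition _ := Finite.on F4.

Definition F4_add (x y : F4) : F4 := (x.1 (+) y.1, x.2 (+) y.2).
Definition F4_mul (x y : F4) : F4 :=
  (x.1 && y.1 (+) x.2 && y.2,
   (x.1 && y.2 (+) x.2 && y.1) (+) x.2 && y.2).
Definition F4_inv (x : F4) : F4 := F4_mul x x.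

Lemma F4_addA : associative F4_add.
Proof. by do 3![case=> [[] []]]. Qed.
Lemma F4_addC : commutative F4_add.
Proof. by do 2![case=> [[] []]]. Qed.
Lemma F4_add0 : left_id (false, false) F4_add.
Proof. by case=> [[] []]. Qed.
Lemma F4_addN : left_inverse (false, false) id F4_add.
Proof. by case=> [[] []]. Qed.
HB.instance Definition _ :=
  GRing.isZmodule.Build F4 F4_addA F4_addC F4_add0 F4_addN.

Lemma F4_mulA : associative F4_mul.
Proof. by do 3![case=> [[] []]]. Qed.
Lemma F4_mulC : commutative F4_mul.
Proof. by do 2![case=> [[] []]]. Qed.
Lemma F4_mul1 : left_id (true, false) F4_mul.
Proof. by case=> [[] []]. Qed.
Lemma F4_mulDl : left_distributive F4_mul +%R.
Proof. by do 3![case=> [[] []]]. Qed.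
Lemma F4_1neq0 : ((true, false) : F4) != 0.
Proof. by []. Qed.
HB.instance Definition _ :=
  GRing.Zmodule_isComNzRing.Build F4 F4_mulA F4_mulC F4_mul1 F4_mulDl F4_1neq0.

Lemma F4_mulV (x : F4) : x != 0 -> F4_inv x * x = 1.
Proof. by case: x => [[] []]. Qed.
Lemma F4_inv0 : F4_inv 0 = 0.
Proof. by []. Qed.
HB.instance Definition _ := GRing.ComNzRing_isField.Build F4 F4_mulV F4_inv0.

Definition alpha : F4 := (false, true).
Definition alphabar : F4 := alpha ^+ 2.

Lemma alphaE : alphabar = 1 + alpha. Proof. by []. Qed.

Definition hexrow (s : seq F4) : 'rV[F4]_6 := \row_(j < 6) nth 0 s j.

Definition hexacode : {vspace 'rV[F4]_6} :=
  <<[:: hexrow [:: 1; 0; 0; 1; alphabar; alpha]%R;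
        hexrow [:: 0; 1; 0; 1; alpha; alphabar]%R;
        hexrow [:: 0; 0; 1; 1; 1; 1]%R]>>%VS.

(* A subset of {0, ..., 23} is its characteristic vector. *)
Notation word := 'rV['F_2]_24.

Definition cell (m n : nat) : 'I_24 := inord (m + 4 * n)%N.
Definition mog (x : word) (m n : nat) : 'F_2 := x 0 (cell m n).

Definition row_label (m : nat) : F4 := nth 0 [:: 0; 1; alpha; alphabar] m.

Definition hmap (x : word) : 'rV[F4]_6 :=
  \row_(n < 6) \sum_(m < 4) row_label m *+ mog x m n.

Definition wsize (x : word) : nat := #|[set i | x 0 i != 0]|.
Definition meet (x y : word) : word := \row_i (x 0 i * y 0 i).

Definition golay_pred : {pred word} := fun x =>
  (hmap x \in hexacode) &&
  [forall n : 'I_6, \sum_(m < 4) mog x m n == \sum_(k < 6) mog x 0 k].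

Lemma F2P (a : 'F_2) : a = 0 \/ a = 1.
Proof. by case: a => [[|[|//]] h]; [left|right]; apply: val_inj. Qed.

Lemma hmap_zmod : zmod_morphism hmap.
Proof.
have e2 (c : F4) : c + c = 0 by case: c => [[] []].
move=> x y; apply/rowP=> n; rewrite !mxE -sumrB; apply: eq_bigr => m _.
rewrite /mog !mxE; move: (row_label m) => c.
have [->|->] := F2P (x 0 (cell m n)); have [->|->] := F2P (y 0 (cell m n));
  by rewrite ?subrr ?subr0 ?sub0r ?oppr_char2 //=; case: c => [[] []].
Qed.
HB.instance Definition _ := GRing.isZmodMorphism.Build word 'rV[F4]_6 hmap hmap_zmod.

Lemma golay_zmod_closed : zmod_closed golay_pred.
Proof.
split=> [|x y /andP[hx /forallP px] /andP[hy /forallP py]]; apply/andP; split.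
- by rewrite raddf0 mem0v.
- apply/forallP=> n; rewrite !big1 // => i _; by rewrite /mog mxE.
- by rewrite raddfB memvB.
- apply/forallP=> n.
  have E (I : finType) (F : I -> 'I_24) :
      \sum_i (x - y) 0 (F i) = \sum_i x 0 (F i) - \sum_i y 0 (F i).
    by rewrite -sumrB; apply: eq_bigr => i _; rewrite !mxE.
  by rewrite /mog !E (eqP (px n)) (eqP (py n)).
Qed.
HB.instance Definition _ := GRing.isZmodClosed.Build word golay_pred golay_zmod_closed.

Record golay : Type := Golay { gword :> word; _ : gword \in golay_pred }.
HB.instance Definition _ := [isSub for gword].
HB.instance Definition _ := [Finite of golay by <:].
HB.instance Definition _ := [SubChoice_isSubZmodule of golay by <:].

(* C^* = F_2^24 / C, and the class of a subset in it. *)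
Definition Cstar : Type := {ideal_quot golay_pred}.
HB.instance Definition _ := GRing.Zmodule.on Cstar.
HB.instance Definition _ := Countable.copy Cstar (can_type (@reprK _ {ideal_quot golay_pred})).
HB.instance Definition _ : isFinite Cstar :=
  CanIsFinite (@reprK _ {ideal_quot golay_pred}).

Definition cls (x : word) : Cstar := \pi_{ideal_quot golay_pred} x.

(* Well defined on classes because C is self-orthogonal. *)
Definition pairing (d : golay) (delta : Cstar) : 'F_2 :=
  (wsize (meet d (generic_quotient.repr delta)))%:R.

(* Both divisions are exact: C is doubly even. *)
Definition Pmap (d : golay) : 'F_2 := (wsize d %/ 4)%:R.
Definition Cmap (d e : golay) : 'F_2 := (wsize (meet d e) %/ 2)%:R.
Definition Amap3 (d e f : golay) : 'F_2 := (wsize (meet (meet d e) f))%:R.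
Definition Amap (d e : golay) : Cstar := cls (meet d e).

Lemma golay1 : const_mx 1 \in golay_pred.
Proof.
apply/andP; split; last first.
  apply/forallP=> n; rewrite /mog; under eq_bigr do rewrite mxE.
  under [X in _ == X]eq_bigr do rewrite mxE.
  by rewrite !sumr_const !card_ord.
suff -> : hmap (const_mx 1) = 0 by rewrite mem0v.
by apply/rowP=> n; rewrite !mxE !big_ord_recl big_ord0 /mog !mxE.
Qed.
Definition Omega : golay := Golay golay1.

Definition gword_ (i : 'I_6) : word :=
  \row_(k < 24) (if (k %/ 4 == i)%N then (k %% 4 != 0)%N else (k %% 4 == 0)%N)%:R.

Lemma mog_gword i (m : 'I_4) (n : 'I_6) :
  mog (gword_ i) m n = ((n == i) (+) (m == 0 :> nat))%:R.
Proof.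
rewrite /mog /cell mxE inordK; last first.
  by apply: (@leq_ltn_trans (3 + 4 * 5)%N); rewrite // leq_add ?leq_mul // -ltnS.
rewrite [(m + _)%N]addnC mulnC divnMDl // modnMDl divn_small // addn0 modn_small //.
by rewrite (inj_eq val_inj); case: eqP.
Qed.

Lemma gword_golay i : gword_ i \in golay_pred.
Proof.
apply/andP; split; last first.
  apply/forallP=> n; under eq_bigr do rewrite mog_gword.
  under [X in _ == X]eq_bigr do rewrite (mog_gword i ord0).
  rewrite !big_ord_recl !big_ord0 /=.
  by case: n => [[|[|[|[|[|[|//]]]]]] hn]; case: i => [[|[|[|[|[|[|//]]]]]] hi].
suff -> : hmap (gword_ i) = 0 by rewrite mem0v.
apply/rowP=> n; rewrite !mxE; under eq_bigr do rewrite mog_gword.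
by rewrite !big_ord_recl big_ord0 /=; case: (n == i).
Qed.

Definition gbasis (i : 'I_6) : golay := Golay (gword_golay i).
Definition gammabasis (i : 'I_6) : Cstar := cls (delta_mx 0 (cell 0 i)).
Definition omega : Cstar := \sum_i gammabasis i.

(* Membership in the subspaces G, H of C and G^*, H^* of C^*. *)
Definition grey (d : golay) : bool :=
  [forall n : 'I_6, (mog d 1 n == mog d 2 n) && (mog d 2 n == mog d 3 n)].
Definition coloured (d : golay) : bool :=
  [forall n : 'I_6, (mog d 0 n == 0) &&
     ((\sum_(m < 4) (mog d m n : nat))%N \in [:: 0; 2]%N)].
Definition greyS (delta : Cstar) : bool :=
  [forall h : golay, coloured h ==> (pairing h delta == 0)].
Definition colouredS (delta : Cstar) : bool :=
  [forall g : golay, grey g ==> (pairing g delta == 0)].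

(* Number of nonzero coefficients of v over a basis b of an F_2-space: over
   F_2 a coefficient vector is the set of indices with coefficient 1.
   The value is junk outside the span of b. *)
Definition weight (V : zmodType) (b : 'I_6 -> V) (v : V) : nat :=
  if [pick J : {set 'I_6} | v == \sum_(i in J) b i] is Some J then #|J| else 0.

Definition wG : golay -> nat := weight gbasis.
Definition wGS : Cstar -> nat := weight gammabasis.
Definition w2G (e : golay) : 'F_2 := 'C(wG e, 2)%:R.
Definition w2GS (eps : Cstar) : 'F_2 := 'C(wGS eps, 2)%:R.

Definition gamma (d : golay) : Cstar :=
  \sum_(i < 6 | (2 <= \sum_(1 <= m < 4) (mog d m i : nat))%N) gammabasis i.

Definition gform (d e : golay) : 'F_2 := pairing d (gamma e).

(* The class theta(d) in C^* representing e |-> theta(d, e). *)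
Definition thetaS (theta : golay -> golay -> 'F_2) (d : golay) : Cstar :=
  odflt 0 [pick delta : Cstar | [forall e, pairing e delta == theta d e]].

Record is_cocycle (theta : golay -> golay -> 'F_2) : Prop := IsCocycle {
  theta_diag : forall d, theta d d = Pmap d;
  theta_sym : forall d e, theta d e + theta e d = Cmap d e;
  theta_Dl : forall d e f, theta (d + e) f = theta d f + theta e f + Amap3 d e f;
  theta_Dr : forall d e f, theta d (e + f) = theta d e + theta d f;
  theta_Omega : forall d, thetaS theta (d + Omega) = thetaS theta d;
  theta_grey : forall e, grey e ->
    thetaS theta e = gamma e *~ ((wG e)%:Z - 1) + omega *+ w2G e;
  theta_gh : forall e h, grey e -> coloured h -> theta e h = 0;
  theta_hg : forall e h, grey e -> coloured h -> theta h e = pairing e (gamma h)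
}.

Definition parker : Type := (golay * 'F_2)%type.
HB.instance Definition _ := Finite.on parker.

Definition pmul (theta : golay -> golay -> 'F_2) (a b : parker) : parker :=
  (a.1 + b.1, a.2 + b.2 + theta a.1 b.1).
Definition pm1 : parker := (0, 1).

(* The relations say that Q is a quotient of the presented group Q_x, and the
   last two fields that it is Q_x itself. *)
Record is_Qx (theta : golay -> golay -> 'F_2) (Q : finGroupType)
    (xP : parker -> Q) (xC : Cstar -> Q) : Prop := IsQx {
  Qx_central : xP pm1 \in 'C([set: Q])%g;
  Qx_P2 : forall d, (xP d ^+ 2 = xP pm1 ^+ Pmap d.1)%g;
  Qx_C2 : forall delta, (xC delta ^+ 2 = 1)%g;
  Qx_PM : forall d e, (xP d * xP e = xP (pmul theta d e) * xC (Amap d.1 e.1))%g;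
  Qx_CD : forall delta eps, (xC delta * xC eps = xC (delta + eps)%R)%g;
  Qx_PC : forall d delta, ([~ xP d, xC delta] = xP pm1 ^+ pairing d.1 delta)%g;
  Qx_gen : <<[set xP d | d : parker] :|: [set xC delta | delta : Cstar]>>%g
             = [set: Q];
  Qx_order : #|Q| = (2 ^ 25)%N
}.

Definition xtilde (theta : golay -> golay -> 'F_2) (Q : finGroupType)
    (xP : parker -> Q) (xC : Cstar -> Q) (d : golay) : Q :=
  (xP (d, 0%R) * xC (thetaS theta d))%g.

Section GroupRing.
Variables (R : comNzRingType) (gT : finGroupType).

(* Functions on gT, with convolution as product. *)
Definition group_ring : Type := {ffun gT -> R^o}.
HB.instance Definition _ := GRing.Lmodule.on group_ring.

Implicit Types f g h : group_ring.

Definition gr (x : gT) : group_ring := [ffun y => (y == x)%:R].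
Definition gr_mul f g : group_ring := [ffun x => \sum_y f y * g (y^-1 * x)%g].

Lemma gr_mulA : associative gr_mul.
Proof.
move=> f g h; apply/ffunP=> x; rewrite !ffunE.
under eq_bigr do rewrite ffunE mulr_sumr.
under [RHS]eq_bigr do rewrite ffunE mulr_suml.
rewrite [RHS]exchange_big /=; apply: eq_bigr => y _.
rewrite (reindex_inj (mulgI (y^-1)%g)) /=; apply: eq_bigr => z _.
by rewrite mulrA invMg invgK mulgA mulgK.
Qed.

Lemma gr_mul1 : left_id (gr 1%g) gr_mul.
Proof.
move=> f; apply/ffunP=> x; rewrite ffunE (bigD1 1%g) //= big1 => [|y /negPf y1].
  by rewrite ffunE eqxx mul1r invg1 mul1g addr0.
by rewrite ffunE y1 mul0r.
Qed.

Lemma gr_mulr1 : right_id (gr 1%g) gr_mul.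
Proof.
move=> f; apply/ffunP=> x; rewrite ffunE (bigD1 x) //= big1 => [|y y1].
  by rewrite ffunE mulVg eqxx mulr1 addr0.
by rewrite ffunE -eq_mulVg1 (negPf y1) mulr0.
Qed.

Lemma gr_mulDl : left_distributive gr_mul +%R.
Proof.
move=> f g h; apply/ffunP=> x; rewrite !ffunE -big_split.
by apply: eq_bigr => y _; rewrite ffunE mulrDl.
Qed.

Lemma gr_mulDr : right_distributive gr_mul +%R.
Proof.
move=> f g h; apply/ffunP=> x; rewrite !ffunE -big_split.
by apply: eq_bigr => y _; rewrite ffunE mulrDr.
Qed.

Lemma gr_1neq0 : gr 1%g != 0.
Proof.
apply/eqP=> /ffunP/(_ 1%g); rewrite !ffunE eqxx => /eqP.
by rewrite (negPf (oner_neq0 R)).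
Qed.

HB.instance Definition _ := GRing.Zmodule_isNzRing.Build group_ring
  gr_mulA gr_mul1 gr_mulr1 gr_mulDl gr_mulDr gr_1neq0.

Lemma gr_scaleAl (a : R) f g : a *: (f * g) = (a *: f) * g.
Proof.
apply/ffunP=> x; rewrite !ffunE scaler_sumr.
by apply: eq_bigr => y _; rewrite ffunE [LHS]mulrA.
Qed.
HB.instance Definition _ := GRing.Lmodule_isLalgebra.Build R group_ring gr_scaleAl.

Lemma gr_scaleAr (a : R) f g : a *: (f * g) = f * (a *: g).
Proof.
apply/ffunP=> x; rewrite !ffunE scaler_sumr.
by apply: eq_bigr => y _; rewrite ffunE [LHS]mulrCA.
Qed.
HB.instance Definition _ := GRing.Lalgebra_isAlgebra.Build R group_ring gr_scaleAr.

End GroupRing.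

Section AlgebraQuotient.
Variables (K : nzRingType) (S : lalgType K) (z : S).

Definition two_sided_ideal : {pred S} := fun u =>
  `[< exists l : seq (S * S), u = \sum_(p <- l) p.1 * z * p.2 >].

Lemma two_sided_idealP u :
  reflect (exists l : seq (S * S), u = \sum_(p <- l) p.1 * z * p.2)
          (u \in two_sided_ideal).
Proof. exact: asboolP. Qed.

Lemma two_sided_ideal_zmod : zmod_closed two_sided_ideal.
Proof.
split=> [|u v /two_sided_idealP[l ->] /two_sided_idealP[l' ->]];
  apply/two_sided_idealP; first by exists [::]; rewrite big_nil.
exists (l ++ [seq (- p.1, p.2) | p <- l']); rewrite big_cat big_map /=.
by congr (_ + _); rewrite -sumrN; apply: eq_bigr => p _; rewrite !mulNr.
Qed.
HB.instance Definition _ :=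
  GRing.isZmodClosed.Build S two_sided_ideal two_sided_ideal_zmod.

Lemma two_sided_idealMl a u : u \in two_sided_ideal -> a * u \in two_sided_ideal.
Proof.
move=> /two_sided_idealP[l ->]; apply/two_sided_idealP.
exists [seq (a * p.1, p.2) | p <- l]; rewrite big_map mulr_sumr.
by apply: eq_bigr => p _; rewrite !mulrA.
Qed.

Lemma two_sided_idealMr a u : u \in two_sided_ideal -> u * a \in two_sided_ideal.
Proof.
move=> /two_sided_idealP[l ->]; apply/two_sided_idealP.
exists [seq (p.1, p.2 * a) | p <- l]; rewrite big_map mulr_suml.
by apply: eq_bigr => p _; rewrite !mulrA.
Qed.

Definition alg_quot : Type := {ideal_quot two_sided_ideal}.
HB.instance Definition _ := GRing.Zmodule.on alg_quot.

Definition to_quot (u : S) : alg_quot := \pi_{ideal_quot two_sided_ideal} u.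
Definition of_quot (q : alg_quot) : S := generic_quotient.repr q.

Lemma of_quotK : cancel of_quot to_quot.
Proof. exact: reprK. Qed.

Lemma to_quot_eq u v : (to_quot u = to_quot v) <-> u - v \in two_sided_ideal.
Proof. by rewrite Quotient.idealrBE; split=> [/eqP|/eqP]. Qed.

Lemma to_quot_zmod : zmod_morphism to_quot.
Proof. by move=> u v; rewrite /to_quot raddfB. Qed.
HB.instance Definition _ := GRing.isZmodMorphism.Build S alg_quot to_quot to_quot_zmod.

Definition quot_one : alg_quot := to_quot 1.
Definition quot_mul (p q : alg_quot) : alg_quot := to_quot (of_quot p * of_quot q).
Definition quot_scale (a : K) (p : alg_quot) : alg_quot := to_quot (a *: of_quot p).

Lemma quot_mulE u v : quot_mul (to_quot u) (to_quot v) = to_quot (u * v).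
Proof.
apply/to_quot_eq; set u' := of_quot _; set v' := of_quot _.
have hu : u' - u \in two_sided_ideal by apply/to_quot_eq; rewrite of_quotK.
have hv : v' - v \in two_sided_ideal by apply/to_quot_eq; rewrite of_quotK.
have -> : u' * v' - u * v = u' * (v' - v) + (u' - u) * v.
  by rewrite mulrBr mulrBl addrA subrK.
by rewrite rpredD //; [apply: two_sided_idealMl | apply: two_sided_idealMr].
Qed.

Lemma quot_scaleE a u : quot_scale a (to_quot u) = to_quot (a *: u).
Proof.
apply/to_quot_eq; rewrite -scalerBr -[_ - u]mul1r scalerAl.
by rewrite two_sided_idealMl //; apply/to_quot_eq; rewrite of_quotK.
Qed.

Lemma quot_mulA : associative quot_mul.
Proof.
move=> p q r; rewrite -[p]of_quotK -[q]of_quotK -[r]of_quotK.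
by rewrite !quot_mulE mulrA.
Qed.
Lemma quot_mul1 : left_id quot_one quot_mul.
Proof. by move=> p; rewrite -[p]of_quotK quot_mulE mul1r. Qed.
Lemma quot_mulr1 : right_id quot_one quot_mul.
Proof. by move=> p; rewrite -[p]of_quotK quot_mulE mulr1. Qed.
Lemma quot_mulDl : left_distributive quot_mul +%R.
Proof.
move=> p q r; rewrite -[p]of_quotK -[q]of_quotK -[r]of_quotK.
by rewrite -raddfD !quot_mulE mulrDl raddfD.
Qed.
Lemma quot_mulDr : right_distributive quot_mul +%R.
Proof.
move=> p q r; rewrite -[p]of_quotK -[q]of_quotK -[r]of_quotK.
by rewrite -raddfD !quot_mulE mulrDr raddfD.
Qed.
HB.instance Definition _ := GRing.Zmodule_isPzRing.Build alg_quot
  quot_mulA quot_mul1 quot_mulr1 quot_mulDl quot_mulDr.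

Lemma quot_scaleA a b p : quot_scale a (quot_scale b p) = quot_scale (a * b) p.
Proof. by rewrite -[p]of_quotK !quot_scaleE scalerA. Qed.
Lemma quot_scale1 : left_id 1 quot_scale.
Proof. by move=> p; rewrite -[p]of_quotK quot_scaleE scale1r. Qed.
Lemma quot_scaleDr : right_distributive quot_scale +%R.
Proof.
move=> a p q; rewrite -[p]of_quotK -[q]of_quotK.
by rewrite -raddfD !quot_scaleE scalerDr raddfD.
Qed.
Lemma quot_scaleDl p : {morph quot_scale^~ p : a b / a + b}.
Proof.
by move=> a b; rewrite -[p]of_quotK !quot_scaleE scalerDl raddfD.
Qed.
HB.instance Definition _ := GRing.Zmodule_isLmodule.Build K alg_quot
  quot_scaleA quot_scale1 quot_scaleDr quot_scaleDl.

End AlgebraQuotient.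

(* R Q^{+-}: the group ring of Q with the element x of Q identified with the
   scalar -1, and the canonical map from Q to it. *)
Definition RQpm (R : realType) (Q : finGroupType) (x : Q) : Type :=
  alg_quot (gr R x - (-1)).
HB.instance Definition _ R Q x := GRing.PzRing.on (@RQpm R Q x).
HB.instance Definition _ R Q x := GRing.Lmodule.on (@RQpm R Q x).

Definition inQ (R : realType) (Q : finGroupType) (x y : Q) : RQpm R x :=
  to_quot (gr R x - (-1)) (gr R y).

Section Xi.
Variables (R : realType) (theta : golay -> golay -> 'F_2) (Q : finGroupType).
Variables (xP : parker -> Q) (xC : Cstar -> Q).

Definition xi_gamma : RQpm R (xP pm1) :=
  8^-1 *: \sum_(eps : Cstar | greyS eps) (-1) ^+ w2GS eps *: inQ R (xP pm1) (xC eps).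
Definition xi_g : RQpm R (xP pm1) :=
  8^-1 *: \sum_(e : golay | grey e)
            (-1) ^+ w2G e *: inQ R (xP pm1) (xtilde theta xP xC e).
Definition xi : RQpm R (xP pm1) := xi_gamma * xi_g.

End Xi.

(* Main.v *)
Require Import Defs.
From mathcomp Require Import all_boot all_order all_algebra all_fingroup.
From mathcomp Require Import boolp reals zify.

Set Implicit Arguments.
Unset Strict Implicit.
Unset Printing Implicit Defensive.

Import GRing.Theory Num.Theory.
Local Open Scope ring_scope.

(** Correcting [x_d] to [x~_d = x_d x_theta(d)] turns the twisted group [Q_x]
    into a Heisenberg group: the cocycle identity of [theta] says exactly that
    [x~] is a homomorphism on the Golay code [C] ([xtD]). So every element of
    [Q_x] is [z^k x~_d x_delta] with [d] in [C] and [delta] in [C^*], and the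
    only noncommutation is the sign [<d, delta>] of the pairing
    ([normal_form_mul]).

    The grey spaces [G] and [G^*] both have coordinates in [F_2^6]. In these
    coordinates both weights [w_2] are the quadratic form
    [qform v = C(|v|, 2)] mod 2, its polar form [bform] is nondegenerate
    ([qformD], [bform_repr]), and the pairing between [G] and [G^*] is again
    [bform] ([pairing_greyvec]). Hence [xi_gamma] and [xi_g] are two instances
    of one Gauss sum [1/8 sum_v (-1)^(qform v) x_v]. Completing the square
    shows that it is an involution ([gauss_sqr]), and that it conjugates an
    element [y] which commutes with each [x_v] up to the sign
    [(-1)^(bform u v)] to [(-1)^(qform u) y x_u] ([gauss_conj]).

    With [h] coloured and [eta] in [H^*], the pair [(h, eta)] pairs trivially
    with the grey spaces, and so [xi_gamma] and [xi_g] act on the grey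
    coordinates [(u, v)] of [x~_d x~_h x_epsilon x_eta] by transvections; their
    product is [(u, v) |-> (v, u + v)], with the sign of [xi_conj]. Applying it
    once and twice gives the first two formulas. In the third, [theta(h)] and
    [gamma(h)] agree on [G], so that [x_h x_gamma(h)] has grey coordinates
    [(0, 0)].

    What this needs of the Golay code is that the pairing of [C] and [C^*] is
    well defined and perfect, that is, self-duality of [C] ([golay_orth],
    [golay_dual]), and the decomposition of [C] into grey and coloured words
    ([golay_decomposition]). Self-duality comes from the hexacode by a formula
    for the inner product of two columns of the MOG ([dotE_col]). *)

(** * Words modulo two and the MOG array *)

Lemma addF2 (a : 'F_2) : a + a = 0.
Proof. by case: (F2P a) => ->; apply: val_inj. Qed.

Lemma F2_add_eq0 (a b : 'F_2) : a + b = 0 -> a = b.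
Proof. by move=> h; rewrite -[b]add0r -h -addrA addF2 addr0. Qed.

Lemma addw (x : word) : x + x = 0.
Proof. by apply/rowP=> i; rewrite !mxE addF2. Qed.

Lemma addgolay (d : golay) : d + d = 0.
Proof. by apply: val_inj; rewrite GRing.valD GRing.val0 addw. Qed.

Lemma clsD : {morph cls : x y / x + y}.
Proof. by move=> x y; rewrite /cls raddfD. Qed.

Lemma cls_repr (delta : Cstar) : cls (generic_quotient.repr delta) = delta.
Proof. exact: reprK. Qed.

Lemma cls_eqP x y : cls x = cls y <-> x - y \in golay_pred.
Proof. by rewrite Quotient.idealrBE; split=> [/eqP|/eqP]. Qed.

Lemma cls0 : cls 0 = 0.
Proof. by rewrite /cls raddf0. Qed.

Lemma addCstar (delta : Cstar) : delta + delta = 0.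
Proof. by rewrite -[delta]cls_repr -clsD addw cls0. Qed.

Definition dot (x y : word) : 'F_2 := \sum_i x 0 i * y 0 i.

Lemma dotDl x y w : dot (x + y) w = dot x w + dot y w.
Proof. by rewrite -big_split; apply: eq_bigr => i _; rewrite mxE mulrDl. Qed.

Lemma dotC x y : dot x y = dot y x.
Proof. by apply: eq_bigr => i _; rewrite mulrC. Qed.

Lemma card_F2 (I : finType) (f : I -> 'F_2) :
  #|[set i | f i != 0]|%:R = \sum_i f i :> 'F_2.
Proof.
rewrite -sum1dep_card natr_sum big_mkcond; apply: eq_bigr => i _.
by case: (F2P (f i)) => ->.
Qed.

Lemma wsizeE x : (wsize x)%:R = \sum_i x 0 i :> 'F_2.
Proof. exact: card_F2. Qed.

Lemma pairing_repr d delta :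
  pairing d delta = dot d (generic_quotient.repr delta).
Proof. by rewrite /pairing wsizeE; apply: eq_bigr => i _; rewrite mxE. Qed.

Lemma val_cell (m : 'I_4) (n : 'I_6) : cell m n = (m + 4 * n)%N :> nat.
Proof.
rewrite /cell inordK //.
by apply: (@leq_ltn_trans (3 + 4 * 5)%N); rewrite // leq_add ?leq_mul // -ltnS.
Qed.

Lemma cell_surj (i : 'I_24) : exists m : 'I_4, exists n : 'I_6, i = cell m n.
Proof.
exists (inord (i %% 4)), (inord (i %/ 4)); apply: val_inj.
have lt6 : (i %/ 4 < 6)%N by rewrite ltn_divLR.
by rewrite /= val_cell !inordK ?ltn_mod // addnC mulnC -divn_eq.
Qed.

Lemma cell_inj (m m' : 'I_4) (n n' : 'I_6) :
  cell m n = cell m' n' -> m = m' /\ n = n'.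
Proof.
move=> /(congr1 val); rewrite /= !val_cell => e.
have em : m = m'.
  apply: val_inj; move: (congr1 (modn^~ 4) e).
  by rewrite /= ![(4 * _)%N]mulnC ![(_ + _ * 4)%N]addnC !modnMDl !modn_small.
split=> //; apply: val_inj; move/eqP: e; rewrite em eqn_add2l eqn_pmul2l //.
by move/eqP.
Qed.

Lemma sum_cell (f : 'I_24 -> 'F_2) :
  \sum_i f i = \sum_(n < 6) \sum_(m < 4) f (cell m n).
Proof.
rewrite pair_bigA /= (reindex (fun p : 'I_6 * 'I_4 => cell p.2 p.1)) //=.
apply: onW_bij; apply: inj_card_bij; last by rewrite card_prod !card_ord.
by move=> [n m] [n' m'] /cell_inj[/= -> ->].
Qed.

Lemma mogP (x y : word) :
  (forall (m : 'I_4) (n : 'I_6), mog x m n = mog y m n) -> x = y.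
Proof. by move=> h; apply/rowP=> i; case: (cell_surj i) => m [n ->]; apply: h. Qed.

Lemma mogD x y m n : mog (x + y) m n = mog x m n + mog y m n.
Proof. by rewrite /mog mxE. Qed.

Lemma mog_row (f : nat -> nat -> 'F_2) (m : 'I_4) (n : 'I_6) :
  mog (\row_(k < 24) f (k %% 4)%N (k %/ 4)%N) m n = f m n.
Proof.
rewrite /mog mxE val_cell addnC mulnC divnMDl // modnMDl.
by rewrite divn_small // addn0 modn_small.
Qed.

Definition colsum (x : word) (n : nat) : 'F_2 := \sum_(m < 4) mog x m n.
Definition row0sum (x : word) : 'F_2 := \sum_(k < 6) mog x 0 k.

Lemma golay_predP (x : word) :
  reflect (hmap x \in hexacode /\ forall n : 'I_6, colsum x n = row0sum x)
          (x \in golay_pred).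
Proof.
apply: (iffP andP) => -[hx px]; split=> //.
  by move=> n; apply/eqP/(forallP px).
by apply/forallP=> n; apply/eqP/px.
Qed.

(** * The hexacode as a symplectic space *)

(** The trace from [F_4] to [F_2] of [a] times the conjugate of [b], which is
    the only nonzero alternating form on the [F_2]-plane [F_4]. *)
Definition sympl (a b : F4) : 'F_2 := ((a.1 && b.2) (+) (a.2 && b.1))%:R.

Lemma hmapE x (n : 'I_6) : hmap x 0 n =
  (mog x 1 n + mog x 3 n != 0, mog x 2 n + mog x 3 n != 0).
Proof.
rewrite mxE !big_ord_recl big_ord0 /=.
case: (F2P (mog x 0 n)) => ->; case: (F2P (mog x 1 n)) => ->;
case: (F2P (mog x 2 n)) => ->; case: (F2P (mog x 3 n)) => -> //.
Qed.

Lemma colsumE x n : colsum x n = mog x 0 n + mog x 1 n + mog x 2 n + mog x 3 n.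
Proof. by rewrite /colsum !big_ord_recl big_ord0 /= addr0 !addrA. Qed.

(** Quantifiers in computable form: a polynomial identity in finitely many
    variables over [F_2] or [F_4] becomes a closed boolean, to be evaluated.
    *)
Definition allF2 (P : pred 'F_2) := P 0 && P 1.

Lemma allF2P (P : pred 'F_2) : reflect (forall a, P a) (allF2 P).
Proof.
apply: (iffP andP) => [[P0 P1] a|h]; last by split; apply: h.
by case: (F2P a) => ->.
Qed.

Definition allF4 (P : pred F4) :=
  [&& P (false, false), P (false, true), P (true, false) & P (true, true)].

Lemma allF4P (P : pred F4) : reflect (forall a, P a) (allF4 P).
Proof.
apply: (iffP and4P) => [[] ? ? ? ? [[] []] //|h]; split; exact: h.
Qed.

(** A column of [x] is determined by its entry in row 0, its parity and its
    label sum: it is the sum of row-0-entry times [1111], parity times [0111],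
    and the word with zero in row 0, even parity and the prescribed label sum.
    Expanding the inner product of two such columns gives the summand. So the
    inner product splits into a part seen by the parity condition and a part
    seen by the hexacode. *)
Lemma dotE_col x y : dot x y = \sum_(n < 6)
  (mog x 0 n * colsum y n + colsum x n * mog y 0 n + colsum x n * colsum y n
   + sympl (hmap x 0 n) (hmap y 0 n)).
Proof.
have col : allF2 (fun a0 => allF2 (fun a1 => allF2 (fun a2 => allF2 (fun a3 =>
    allF2 (fun b0 => allF2 (fun b1 => allF2 (fun b2 => allF2 (fun b3 =>
    a0 * b0 + (a1 * b1 + (a2 * b2 + (a3 * b3 + 0))) ==
    a0 * (b0 + b1 + b2 + b3) + (a0 + a1 + a2 + a3) * b0
    + (a0 + a1 + a2 + a3) * (b0 + b1 + b2 + b3)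
    + sympl (a1 + a3 != 0, a2 + a3 != 0) (b1 + b3 != 0, b2 + b3 != 0))))))))).
  by vm_compute.
rewrite /dot sum_cell; apply: eq_bigr => n _.
rewrite !big_ord_recl big_ord0 !hmapE !colsumE.
move: col => /allF2P/(_ (mog x 0 n))/allF2P/(_ (mog x 1 n)).
move=> /allF2P/(_ (mog x 2 n))/allF2P/(_ (mog x 3 n)).
move=> /allF2P/(_ (mog y 0 n))/allF2P/(_ (mog y 1 n)).
by move=> /allF2P/(_ (mog y 2 n))/allF2P/(_ (mog y 3 n))/eqP <-.
Qed.

(** The codeword of the hexacode with given first three coordinates. *)
Definition hexgen (a b c : F4) : 'rV[F4]_6 :=
  hexrow [:: a; b; c; a + b + c; alphabar * a + alpha * b + c;
             alpha * a + alphabar * b + c].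

Lemma hexacodeP v : reflect (exists a b c, v = hexgen a b c) (v \in hexacode).
Proof.
apply: (iffP idP).
  rewrite /hexacode !span_cons span_nil addv0.
  case/memv_addP=> _ /vlineP[a ->] [_ /memv_addP[_ /vlineP[b ->] [_ /vlineP[c ->] ->]] ->].
  exists a, b, c; apply/rowP=> n; rewrite !mxE.
  case: n => [[|[|[|[|[|[|//]]]]]] hn] /=;
  by rewrite ?mulr0 ?mulr1 ?add0r ?addr0 ?addrA // ![_ * alpha]mulrC
     ![_ * alphabar]mulrC.
case=> a [b [c ->]].
have -> : hexgen a b c = a *: hexrow [:: 1; 0; 0; 1; alphabar; alpha]
  + b *: hexrow [:: 0; 1; 0; 1; alpha; alphabar]
  + c *: hexrow [:: 0; 0; 1; 1; 1; 1].
  apply/rowP=> n; rewrite !mxE.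
  case: n => [[|[|[|[|[|[|//]]]]]] hn] /=;
  by rewrite ?mulr0 ?mulr1 ?add0r ?addr0 ?addrA // ![_ * alpha]mulrC
     ![_ * alphabar]mulrC.
by rewrite !memvD ?memvZ // memv_span // !inE eqxx ?orbT.
Qed.

Definition hexform (u v : 'rV[F4]_6) : 'F_2 := \sum_n sympl (u 0 n) (v 0 n).

(** The hexacode is Hermitian self-orthogonal, hence isotropic for the trace
    form. *)
Lemma hexgen_orth a b c a' b' c' :
  hexform (hexgen a b c) (hexgen a' b' c') = 0.
Proof.
have all : allF4 (fun a => allF4 (fun b => allF4 (fun c =>
    allF4 (fun a' => allF4 (fun b' => allF4 (fun c' =>
    sympl a a' + (sympl b b' + (sympl c c' + (sympl (a + b + c) (a' + b' + c') +
    (sympl (alphabar * a + alpha * b + c) (alphabar * a' + alpha * b' + c') +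
    (sympl (alpha * a + alphabar * b + c) (alpha * a' + alphabar * b' + c')
      + 0))))) == 0)))))).
  by vm_compute.
rewrite /hexform !big_ord_recl big_ord0 !mxE.
move: all => /allF4P/(_ a)/allF4P/(_ b)/allF4P/(_ c).
by move=> /allF4P/(_ a')/allF4P/(_ b')/allF4P/(_ c')/eqP.
Qed.

Lemma hexacode_orth u v : u \in hexacode -> v \in hexacode -> hexform u v = 0.
Proof.
move=> /hexacodeP[a [b [c ->]]] /hexacodeP[a' [b' [c' ->]]].
exact: hexgen_orth.
Qed.

(** The hexacode is a maximal isotropic subspace: pairing [u] with the six
    codewords that generate the hexacode over [F_2] yields the equations that
    express the last three coordinates of [u] by the first three. *)
Lemma hexacode_dual u :
  (forall v, v \in hexacode -> hexform v u = 0) -> u \in hexacode.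
Proof.
move=> orth.
pose eqn (a b c : F4) u0 u1 u2 u3 u4 u5 := sympl a u0 + (sympl b u1 + (sympl c u2 +
  (sympl (a + b + c) u3 + (sympl (alphabar * a + alpha * b + c) u4 +
    (sympl (alpha * a + alphabar * b + c) u5 + 0))))).
have all : allF4 (fun u0 => allF4 (fun u1 => allF4 (fun u2 =>
    allF4 (fun u3 => allF4 (fun u4 => allF4 (fun u5 =>
    [&& eqn 1 0 0 u0 u1 u2 u3 u4 u5 == 0, eqn alpha 0 0 u0 u1 u2 u3 u4 u5 == 0,
        eqn 0 1 0 u0 u1 u2 u3 u4 u5 == 0, eqn 0 alpha 0 u0 u1 u2 u3 u4 u5 == 0,
        eqn 0 0 1 u0 u1 u2 u3 u4 u5 == 0 & eqn 0 0 alpha u0 u1 u2 u3 u4 u5 == 0] ==>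
    [&& u3 == u0 + u1 + u2, u4 == alphabar * u0 + alpha * u1 + u2
      & u5 == alpha * u0 + alphabar * u1 + u2]))))))
  by vm_compute.
pose w i : F4 := u 0 (inord i).
have wE (n : 'I_6) : u 0 n = w n by rewrite /w inord_val.
have eqn0 a b c : eqn a b c (w 0) (w 1) (w 2) (w 3) (w 4) (w 5) == 0.
  have := orth (hexgen a b c); rewrite /hexform !big_ord_recl big_ord0 !mxE !wE.
  by move=> h; apply/eqP/h/hexacodeP; exists a, b, c.
move: all => /allF4P/(_ (w 0))/allF4P/(_ (w 1))/allF4P/(_ (w 2)).
move=> /allF4P/(_ (w 3))/allF4P/(_ (w 4))/allF4P/(_ (w 5)).
rewrite !eqn0 => /and3P[/eqP e3 /eqP e4 /eqP e5].
apply/hexacodeP; exists (w 0), (w 1), (w 2); apply/rowP=> n; rewrite mxE wE.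
by case: n => [[|[|[|[|[|[|//]]]]]] hn].
Qed.

(** * Self-duality of the Golay code *)

(** The coloured word with label sums [v]: since the three nonzero labels add
    up to 0, an even set of rows among 1, 2, 3 has label sum [c] exactly when
    it omits the row labelled [c] (or is empty, for [c = 0]). *)
Definition col_word (v : 'rV[F4]_6) : word :=
  \row_(k < 24) (nth false [:: false; (v 0 (inord (k %/ 4))).2;
     (v 0 (inord (k %/ 4))).1;
     (v 0 (inord (k %/ 4))).1 (+) (v 0 (inord (k %/ 4))).2] (k %% 4))%:R.

Lemma mog_col_word v (m : 'I_4) (n : 'I_6) :
  mog (col_word v) m n =
  (nth false [:: false; (v 0 n).2; (v 0 n).1; (v 0 n).1 (+) (v 0 n).2] m)%:R.
Proof.
rewrite /col_word (mog_row (fun m n => (nth false [:: false; (v 0 (inord n)).2;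
     (v 0 (inord n)).1; (v 0 (inord n)).1 (+) (v 0 (inord n)).2] m)%:R)).
by rewrite inord_val.
Qed.

Lemma mog_col_word0 v (n : 'I_6) : mog (col_word v) 0 n = 0.
Proof. exact: (mog_col_word v ord0). Qed.

Lemma colsum_col_word v (n : 'I_6) : colsum (col_word v) n = 0.
Proof.
rewrite /colsum; under eq_bigr do rewrite mog_col_word.
rewrite !big_ord_recl big_ord0; case: (v 0 n) => [[] []]; exact: val_inj.
Qed.

Lemma hmap_col_word v : hmap (col_word v) = v.
Proof.
apply/rowP=> n; rewrite mxE; under eq_bigr do rewrite mog_col_word.
rewrite !big_ord_recl big_ord0; case: (v 0 n) => [[] []] //.
Qed.

Lemma col_word_golay v : v \in hexacode -> col_word v \in golay_pred.
Proof.
move=> hv; apply/golay_predP; rewrite hmap_col_word; split=> // n.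
rewrite colsum_col_word /row0sum big1 // => k _; exact: mog_col_word0.
Qed.

Lemma colsum_gword i (n : 'I_6) : colsum (gword_ i) n = 1.
Proof.
rewrite /colsum; under eq_bigr do rewrite mog_gword.
by rewrite !big_ord_recl big_ord0 /=; case: (n == i); apply: val_inj.
Qed.

Lemma hmap_gword i : hmap (gword_ i) = 0.
Proof.
apply/rowP=> n; rewrite !mxE; under eq_bigr do rewrite mog_gword.
by rewrite !big_ord_recl big_ord0 /=; case: (n == i).
Qed.

Lemma mog_gword0 i (n : 'I_6) : mog (gword_ i) 0 n = (n != i)%:R.
Proof. by rewrite (mog_gword i ord0) /= addbT. Qed.

Lemma sympl0 a : sympl 0 a = 0.
Proof. by case: a => [[] []]. Qed.

Lemma sum6_const (a : 'F_2) : \sum_(n < 6) a = 0.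
Proof. by rewrite sumr_const card_ord; case: (F2P a) => ->; apply: val_inj. Qed.

Lemma sum_neq (i : 'I_6) (f : 'I_6 -> 'F_2) :
  \sum_n (n != i)%:R * f n = \sum_n f n + f i.
Proof.
rewrite [in RHS](bigD1 i) //= addrAC addF2 add0r [RHS]big_mkcond /=.
by apply: eq_bigr => n _; case: (n != i); rewrite ?mul1r ?mul0r.
Qed.

(** In the column formula for the inner product the hexacode part vanishes;
    writing [p] and [q] for the common column parities, equal to the sums of
    row 0, the rest is [q p + p q + 6 p q = 0]. *)
Lemma golay_orth x y : x \in golay_pred -> y \in golay_pred -> dot x y = 0.
Proof.
move=> /golay_predP[hx px] /golay_predP[hy py].
rewrite dotE_col !big_split /= -/(hexform _ _) hexacode_orth // addr0.
under eq_bigr do rewrite py; under [X in _ + X + _]eq_bigr do rewrite px.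
under [X in _ + _ + X]eq_bigr do rewrite px py.
by rewrite -mulr_suml -mulr_sumr sum6_const addr0 addF2.
Qed.

(** The parity checks that define the code are themselves codewords: the
    coloured word of [v] tests the label sums against [v], and [gword_ i]
    compares the parity of column [i] with the sum of row 0. *)
Lemma golay_dual y : (forall x, x \in golay_pred -> dot x y = 0) -> y \in golay_pred.
Proof.
move=> orth; apply/golay_predP; split=> [|i].
  apply: hexacode_dual => v hv; rewrite -(orth _ (col_word_golay hv)) dotE_col.
  apply: eq_bigr => n _.
  by rewrite mog_col_word0 colsum_col_word hmap_col_word !mul0r !add0r.
(* The word [gword_ i] has label sums 0 and odd columns, and row 0 is full
   except in column [i]. *)
apply: F2_add_eq0; rewrite -(orth _ (gword_golay i)) dotE_col.
rewrite (eq_bigr (fun n : 'I_6 => (n != i)%:R * colsum y n + mog y 0 n + colsum y n)).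
  rewrite !big_split /= sum_neq addrAC [X in _ = X + _]addrAC addF2 add0r.
  by rewrite /row0sum.
move=> n _; rewrite mog_gword0 colsum_gword hmap_gword mxE sympl0 addr0 !mul1r.
by [].
Qed.

(** Self-orthogonality makes the pairing independent of the representative. *)
Lemma pairing_cls (d : golay) w : pairing d (cls w) = dot d w.
Proof.
rewrite pairing_repr; apply: F2_add_eq0; rewrite !(dotC d) -dotDl.
rewrite (_ : _ + _ = generic_quotient.repr (cls w) - w).
  apply: golay_orth; last exact: valP.
  exact: (cls_eqP _ _).1 (cls_repr _).
by congr (_ + _); apply/rowP=> i; rewrite !mxE oppr_pchar2.
Qed.

Lemma pairingDr d : {morph pairing d : x y / x + y}.
Proof.
move=> x y; rewrite -[x]cls_repr -[y]cls_repr -clsD !pairing_cls !(dotC d).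
exact: dotDl.
Qed.

Lemma pairingDl delta : {morph pairing^~ delta : x y / x + y}.
Proof.
by move=> x y; rewrite -[delta]cls_repr !pairing_cls /= -dotDl.
Qed.

Lemma pairing0r d : pairing d 0 = 0.
Proof. by rewrite -(addF2 (pairing d 0)) -pairingDr addr0. Qed.

Lemma pairing0l delta : pairing 0 delta = 0.
Proof. by rewrite -(addF2 (pairing 0 delta)) -pairingDl addr0. Qed.

Lemma pairing_nondeg delta : (forall d, pairing d delta = 0) -> delta = 0.
Proof.
move=> h; rewrite -cls0 -[delta]cls_repr; apply/cls_eqP; rewrite subr0.
apply: golay_dual => x hx; rewrite -(h (Golay hx)) -[in RHS](cls_repr delta).
by rewrite pairing_cls.
Qed.

Lemma pairing_inj delta eps :
  (forall d, pairing d delta = pairing d eps) -> delta = eps.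
Proof.
move=> h; have e : delta + eps = 0.
  by apply: pairing_nondeg => d; rewrite pairingDr h addF2.
by rewrite -[delta]addr0 -(addCstar eps) addrA e add0r.
Qed.

(** Extend [phi] to all words along a linear projection onto the code; the
    values of the extension on the unit vectors are the coordinates of
    [delta]. *)
Lemma pairing_perfect (phi : golay -> 'F_2) : {morph phi : x y / x + y} ->
  exists delta, forall d, pairing d delta = phi d.
Proof.
move=> phiD.
have phi0 : phi 0 = 0 by rewrite -(addF2 (phi 0)) -phiD addr0.
(* [F_2] has only the scalars 0 and 1, so the additive group [golay_pred] is
   a subspace. *)
pose U : {vspace word} := <<enum golay_pred>>%VS.
have UP x : (x \in U) = (x \in golay_pred).
  apply/idP/idP=> [|hx]; last by rewrite memv_span // mem_enum; exact: hx.
  move=> /coord_span ->; apply: rpred_sum => i _.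
  have h : (enum golay_pred)`_i \in golay_pred.
    have lt_i : (i < size (enum golay_pred))%N by rewrite -cardE.
    by move: (mem_nth 0 lt_i); rewrite mem_enum; apply.
  case: (F2P (coord (enum_tuple golay_pred) i x)) => ->.
    by rewrite scale0r rpred0.
  by rewrite scale1r.
pose p x : golay := insubd (0 : golay) (projv U x).
have pE x : val (p x) = projv U x.
  have h : projv U x \in golay_pred by rewrite -UP memv_proj.
  exact: (@insubdK word golay_pred golay 0 _ h).
have pD x y : p (x + y) = p x + p y.
  by apply: val_inj; rewrite GRing.valD !pE linearD.
have pK (d : golay) : p d = d.
  by apply: val_inj; rewrite pE projv_id // UP; exact: valP d.
pose psi x := phi (p x).
have psiD : {morph psi : x y / x + y} by move=> x y; rewrite /psi pD phiD.
have p0 : p 0 = 0 by apply: val_inj; rewrite GRing.val0 pE linear0.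
exists (cls (\row_i psi (delta_mx 0 i))) => d.
rewrite pairing_cls -[in RHS](pK d) -/(psi d) [in RHS](row_sum_delta d).
rewrite (big_morph psi psiD (_ : psi 0 = 0)); last by rewrite /psi p0.
apply: eq_bigr => i _; rewrite mxE.
by case: (F2P (gword d 0 i)) => ->; rewrite ?mul0r ?mul1r ?scale0r ?scale1r // /psi p0.
Qed.

(** * The quadratic form of binomial coefficients on F_2^6 *)

Notation F2vec := 'rV['F_2]_6.

Definition supp (v : F2vec) : {set 'I_6} := [set i | v 0 i != 0].
Definition qform (v : F2vec) : 'F_2 := 'C(#|supp v|, 2)%:R.
(** The sum of [u_i * v_j] over [i <> j], in a form that is easier to expand.
    *)
Definition bform (u v : F2vec) : 'F_2 :=
  (\sum_i u 0 i) * (\sum_i v 0 i) + \sum_i u 0 i * v 0 i.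

Lemma addF2vec (v : F2vec) : v + v = 0.
Proof. by apply/rowP=> i; rewrite !mxE addF2. Qed.

Lemma bin2D a b : 'C(a + b, 2) = ('C(a, 2) + 'C(b, 2) + a * b)%N.
Proof.
elim: a => [|a IHa]; first by rewrite mul0n addn0.
by rewrite addSn !binS !bin1 IHa mulSn; lia.
Qed.

Lemma card_supp (v : F2vec) : #|supp v|%:R = \sum_i v 0 i :> 'F_2.
Proof. exact: card_F2. Qed.

Lemma mulF2 (a : 'F_2) : a * a = a.
Proof. by case: (F2P a) => ->; apply: val_inj. Qed.

Lemma bformDl u u' v : bform (u + u') v = bform u v + bform u' v.
Proof.
rewrite /bform [RHS]addrACA -mulrDl -!big_split /=; congr (_ * _ + _).
  by apply: eq_bigr => i _; rewrite mxE.
by apply: eq_bigr => i _; rewrite mxE mulrDl.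
Qed.

Lemma bformC u v : bform u v = bform v u.
Proof. by rewrite /bform mulrC; congr (_ + _); apply: eq_bigr => i _; rewrite mulrC. Qed.

Lemma bformDr u v v' : bform u (v + v') = bform u v + bform u v'.
Proof. by rewrite !(bformC u) bformDl. Qed.

Lemma bform_alt u : bform u u = 0.
Proof.
by rewrite /bform mulF2; under [X in _ + X]eq_bigr do rewrite mulF2; rewrite addF2.
Qed.

(** With [k] common elements the sizes satisfy [|u + v| + 2 k = |u| + |v|].
    Taking binomials, [C(2 k, 2)] has the parity of [k], so [C(|u + v|, 2) +
    k] equals [C(|u|, 2) + C(|v|, 2) + |u| |v|] modulo 2. *)
Lemma qformD u v : qform (u + v) = qform u + qform v + bform u v.
Proof.
rewrite /qform; set A := supp u; set B := supp v; set k := #|A :&: B|.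
have eAB : supp (u + v) = (A :\: B) :|: (B :\: A).
  apply/setP=> i; rewrite !inE mxE.
  by case: (F2P (u 0 i)) => ->; case: (F2P (v 0 i)) => ->.
have card_uv : (#|supp (u + v)| + (k + k) = #|A| + #|B|)%N.
  rewrite eAB cardsU (_ : _ :&: _ = set0) ?cards0 ?subn0; last first.
    by apply/setP=> i; rewrite !inE; case: (u 0 i == 0); case: (v 0 i == 0).
  by rewrite addnACA -{1}(cardsID B A) -{1}(cardsID A B) [B :&: A]setIC
    ![(k + _)%N]addnC.
have kE : k%:R = \sum_i u 0 i * v 0 i :> 'F_2.
  rewrite -card_F2; congr (#|pred_of_set _|%:R); apply/setP=> i; rewrite !inE.
  by case: (F2P (u 0 i)) => ->; case: (F2P (v 0 i)) => ->.
move/(congr1 (fun n => 'C(n, 2)%:R : 'F_2)): card_uv.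
rewrite !bin2D !natrD !natrM !natrD !addF2 mulr0 addr0 add0r mulF2 kE.
by rewrite !card_supp => e; rewrite /bform addrA -e -addrA addF2 addr0.
Qed.

Lemma qform0 : qform 0 = 0.
Proof.
by rewrite /qform (_ : supp 0 = set0) ?cards0 //; apply/setP=> i; rewrite !inE mxE.
Qed.

(** The Gram matrix of [bform] is the all-ones matrix [J] plus the identity.
    As [J * J = 6 J = 0], it is its own inverse, which gives the solution:
    coefficients of [phi] plus their sum. *)
Lemma bform_repr (phi : F2vec -> 'F_2) : {morph phi : u v / u + v} ->
  exists u, forall v, bform u v = phi v.
Proof.
move=> phiD; have phi0 : phi 0 = 0 by rewrite -(addF2 (phi 0)) -phiD addr0.
pose f i := phi (delta_mx 0 i); pose s := \sum_i f i.
exists (\row_i (f i + s)) => v.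
have -> : phi v = \sum_i v 0 i * f i.
  rewrite {1}[v]row_sum_delta (big_morph phi phiD phi0); apply: eq_bigr => i _.
  by case: (F2P (v 0 i)) => ->; rewrite ?scale0r ?scale1r ?mul0r ?mul1r.
rewrite /bform; under eq_bigr do rewrite mxE.
under [X in _ + X]eq_bigr do rewrite mxE mulrDl.
rewrite !big_split /= sum6_const addr0 -mulr_sumr addrCA addF2 addr0.
by apply: eq_bigr => i _; rewrite mulrC.
Qed.

Lemma bform_nondeg v : (forall u, bform u v = 0) -> v = 0.
Proof.
move=> h; apply/rowP=> i; rewrite mxE.
have [|u hu] := @bform_repr (fun v => v 0 i); last by rewrite -hu h.
by move=> x y; rewrite mxE.
Qed.

(** * Grey and coloured parts *)

Section Span.
Variables (W : zmodType) (b : 'I_6 -> W).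
Hypothesis W2 : forall x : W, x + x = 0.

(** The combination of the vectors [b i] with coefficients [v], written as in
    the definition of [weight]. *)
Definition comb (v : F2vec) : W := \sum_(i in supp v) b i.

Lemma combE v : comb v = \sum_i b i *+ v 0 i.
Proof.
rewrite /comb big_mkcond; apply: eq_bigr => i _; rewrite inE.
by case: (F2P (v 0 i)) => ->.
Qed.

Lemma mulrF2D (x : W) (a c : 'F_2) : x *+ (a + c)%R = x *+ a + x *+ c.
Proof.
have [mul0 mul1] : x *+ (0 : 'F_2)%R = 0 /\ x *+ (1 : 'F_2)%R = x by [].
case: (F2P a) => ->; case: (F2P c) => ->;
by rewrite ?addF2 ?add0r ?addr0 ?mul0 ?mul1 ?addr0 ?add0r ?W2.
Qed.

Lemma combD : {morph comb : u v / u + v}.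
Proof.
by move=> u v; rewrite !combE -big_split; apply: eq_bigr => i _; rewrite mxE mulrF2D.
Qed.

Lemma comb0 : comb 0 = 0.
Proof. by rewrite -(W2 (comb 0)) -combD addr0. Qed.

Lemma comb_inj : (forall v, comb v = 0 -> v = 0) -> injective comb.
Proof.
move=> ker0 u v e; have : u + v = 0 by apply: ker0; rewrite combD e W2.
by move=> uv0; apply/rowP=> i; apply: F2_add_eq0; move/rowP/(_ i): uv0; rewrite !mxE.
Qed.

Lemma comb_set (J : {set 'I_6}) :
  exists2 v, supp v = J & comb v = \sum_(i in J) b i.
Proof.
have e : supp (\row_i (i \in J)%:R) = J.
  by apply/setP=> i; rewrite inE mxE; case: (i \in J).
by exists (\row_i (i \in J)%:R); rewrite // /comb e.
Qed.

Lemma weight_comb : injective comb -> forall v, weight b (comb v) = #|supp v|.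
Proof.
move=> inj v; rewrite /weight; case: pickP => [J /eqP e|/(_ (supp v))].
  have [u eJ eu] := comb_set J; rewrite -eJ (_ : u = v) //.
  by apply: inj; rewrite eu.
by rewrite eqxx.
Qed.

End Span.

Definition greyvec : F2vec -> golay := comb gbasis.
Definition greySvec : F2vec -> Cstar := comb gammabasis.

Lemma greyvecD : {morph greyvec : u v / u + v}.
Proof. exact: (combD _ addgolay). Qed.
Lemma greySvecD : {morph greySvec : u v / u + v}.
Proof. exact: (combD _ addCstar). Qed.

Lemma pairing_gammabasis d j : pairing d (gammabasis j) = mog d 0 j.
Proof.
rewrite pairing_cls /dot (bigD1 (cell 0 j)) //= big1 => [|i /negPf ne].
  by rewrite !mxE !eqxx mulr1 addr0.
by rewrite !mxE ne andbF mulr0.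
Qed.

Lemma pairing_greySvec d v : pairing d (greySvec v) = \sum_j v 0 j * mog d 0 j.
Proof.
rewrite /greySvec combE (big_morph _ (@pairingDr d) (@pairing0r d)).
apply: eq_bigr => j _; rewrite -pairing_gammabasis.
by case: (F2P (v 0 j)) => ->; rewrite ?pairing0r ?mul0r ?mul1r.
Qed.

Lemma mog_greyvec u (m : 'I_4) (n : 'I_6) :
  mog (greyvec u) m n = \sum_i u 0 i * ((n == i) (+) (m == 0 :> nat))%:R.
Proof.
have mog_D : {morph (fun d : golay => mog d m n) : x y / x + y}.
  by move=> x y; rewrite -mogD; congr mog; apply: (GRing.valD x y).
have mog_0 : mog (0 : golay) m n = 0 by rewrite /mog (_ : gword 0 = 0) ?mxE.
rewrite /greyvec combE (big_morph _ mog_D mog_0); apply: eq_bigr => i _.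
case: (F2P (u 0 i)) => ->; rewrite ?mul0r ?mul1r //.
exact: mog_gword.
Qed.

Lemma mog_greyvec0 u (n : 'I_6) : mog (greyvec u) 0 n = \sum_i u 0 i + u 0 n.
Proof.
rewrite (mog_greyvec u ord0) -sum_neq; apply: eq_bigr => i _.
by rewrite addbT mulrC eq_sym.
Qed.

Lemma mog_greyvecS u m (n : 'I_6) : (m < 3)%N -> mog (greyvec u) m.+1 n = u 0 n.
Proof.
move=> lt_m3; rewrite (mog_greyvec u (@Ordinal 4 m.+1 lt_m3)) (bigD1 n) //= big1.
  by rewrite eqxx mulr1 addr0.
by move=> i /negPf ne; rewrite eq_sym ne mulr0.
Qed.

(** The pairing of the two grey spaces is the polar form of both weight forms.
    This coincidence lets one and the same Gauss sum serve for [xi_gamma] and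
    for [xi_g]. *)
Lemma pairing_greyvec u v : pairing (greyvec u) (greySvec v) = bform u v.
Proof.
rewrite pairing_greySvec; under eq_bigr do rewrite mog_greyvec0 mulrDr.
rewrite big_split /= -mulr_suml mulrC /bform; congr (_ + _).
by apply: eq_bigr => i _; rewrite mulrC.
Qed.

Lemma greyvec_inj : injective greyvec.
Proof.
apply: (comb_inj addgolay) => v e; apply: bform_nondeg => u.
by rewrite bformC -pairing_greyvec /greyvec e pairing0l.
Qed.

Lemma greySvec_inj : injective greySvec.
Proof.
apply: (comb_inj addCstar) => v e; apply: bform_nondeg => u.
by rewrite -pairing_greyvec /greySvec e pairing0r.
Qed.

Lemma w2G_greyvec u : w2G (greyvec u) = qform u.
Proof. by rewrite /w2G /wG (weight_comb greyvec_inj). Qed.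

Lemma w2GS_greySvec u : w2GS (greySvec u) = qform u.
Proof. by rewrite /w2GS /wGS (weight_comb greySvec_inj). Qed.

Lemma gamma_greyvec u : gamma (greyvec u) = greySvec u.
Proof.
apply: eq_bigl => i; rewrite inE.
rewrite big_add1 big_mkord !big_ord_recl big_ord0 !mog_greyvecS //.
by case: (F2P (u 0 i)) => ->.
Qed.

Lemma grey_greyvec u : grey (greyvec u).
Proof. by apply/forallP=> n; rewrite !mog_greyvecS // eqxx. Qed.

(** The grey part can be read off row 0: the combination of the [g_i] with
    coefficients [u] has entry [s + u_n] in row 0 of column [n], where [s] is
    the sum of [u], and [u_n = d_0n + row0sum d] solves [s + u_n = d_0n]
    because there are six columns. What is left has row 0 zero, hence even
    columns. *)
Lemma golay_decomposition (d : golay) : exists u, coloured (d + greyvec u).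
Proof.
exists (\row_n (mog d 0 n + row0sum d)); set u := \row_n _; set h : golay := _ + _.
have hE m n : mog h m n = mog d m n + mog (greyvec u) m n.
  by rewrite -mogD; congr mog; apply: (GRing.valD d (greyvec u)).
have row0 (n : 'I_6) : mog h 0 n = 0.
  rewrite hE mog_greyvec0; under eq_bigr do rewrite mxE.
  rewrite big_split /= -/(row0sum d) sum6_const addr0 mxE.
  by rewrite addrCA [_ + (_ + row0sum d)]addrA addF2 add0r addF2.
have col (n : 'I_6) : mog h 1 n + mog h 2 n + mog h 3 n = 0.
  have [_ /(_ n)] := golay_predP _ (valP h).
  by rewrite colsumE row0 add0r /row0sum big1.
apply/forallP=> n; rewrite row0 eqxx /= !big_ord_recl big_ord0 row0.
move: (col n); case: (F2P (mog h 1 n)) => ->; case: (F2P (mog h 2 n)) => ->;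
by case: (F2P (mog h 3 n)) => ->.
Qed.

Lemma coloured_row0 h (n : 'I_6) : coloured h -> mog h 0 n = 0.
Proof. by move=> /forallP/(_ n)/andP[/eqP]. Qed.

Lemma grey_coloured_eq0 d : grey d -> coloured d -> d = 0.
Proof.
move=> /forallP gd cd; apply: val_inj; apply: mogP => m n.
have [/andP[/eqP e12 /eqP e23] row0] := (gd n, coloured_row0 n cd).
have m3 : mog d 3 n = 0.
  move/forallP/(_ n)/andP: cd => [_]; rewrite !big_ord_recl big_ord0.
  rewrite row0 [mog d _ n]e12 [mog d (lift _ (lift _ _)) n]e23.
  by case: (F2P (mog d 3 n)) => ->.
rewrite [RHS](_ : _ = 0); last by rewrite /mog mxE.
by case: m => [[|[|[|[|//]]]] lt_m] /=; rewrite ?row0 ?e12 ?e23 ?m3.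
Qed.

Lemma greyD d e : grey d -> grey e -> grey (d + e).
Proof.
move=> /forallP gd /forallP ge; apply/forallP=> n.
have hE m : mog (d + e) m n = mog d m n + mog e m n.
  by rewrite -mogD; congr mog; apply: (GRing.valD d e).
move: (gd n) (ge n) => /andP[/eqP d1 /eqP d2] /andP[/eqP e1 /eqP e2].
by rewrite !hE d1 d2 e1 e2 eqxx.
Qed.

Lemma greyP d : reflect (exists u, d = greyvec u) (grey d).
Proof.
apply: (iffP idP) => [gd|[u ->]]; last exact: grey_greyvec.
have [u cd] := golay_decomposition d; exists u.
have /grey_coloured_eq0/(_ cd) e := greyD gd (grey_greyvec u).
by rewrite -[d]addr0 -(addgolay (greyvec u)) addrA e add0r.
Qed.

(** A class that kills the coloured words is determined by its values on the
    grey words, and [bform] being nondegenerate, these values are those of a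
    combination of the [gamma_i]. *)
Lemma greySP delta : reflect (exists u, delta = greySvec u) (greyS delta).
Proof.
apply: (iffP forallP) => [gS|[u ->] h]; last first.
  apply/implyP=> ch; rewrite pairing_greySvec big1 // => j _.
  by rewrite coloured_row0 ?mulr0.
have [|u hu] := @bform_repr (fun v => pairing (greyvec v) delta).
  by move=> v w; rewrite greyvecD pairingDl.
exists u; apply: pairing_inj => d; have [v cd] := golay_decomposition d.
have -> : d = d + greyvec v + greyvec v by rewrite -addrA addgolay addr0.
rewrite !(pairingDl _ (d + _)) pairing_greyvec bformC hu; congr (_ + _).
rewrite (eqP (implyP (gS _) cd)) pairing_greySvec big1 // => j _.
by rewrite coloured_row0 ?mulr0.
Qed.

(** * Gauss sums in the signed group ring *)

Lemma quot_scale_mull (K : nzRingType) (S : lalgType K) (z : S) (a : K)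
    (p q : alg_quot z) :
  quot_scale a (quot_mul p q) = quot_mul (quot_scale a p) q.
Proof.
rewrite -[p]of_quotK -[q]of_quotK.
by rewrite quot_mulE !quot_scaleE quot_mulE scalerAl.
Qed.

Lemma quot_scale_mulr (K : nzRingType) (S : algType K) (z : S) (a : K)
    (p q : alg_quot z) :
  quot_scale a (quot_mul p q) = quot_mul p (quot_scale a q).
Proof.
rewrite -[p]of_quotK -[q]of_quotK.
by rewrite quot_mulE !quot_scaleE quot_mulE scalerAr.
Qed.

Section SignedGroupRing.
Variables (R : realType) (Q : finGroupType) (z : Q).
Local Notation A := (RQpm R z).
Local Notation iota := (inQ R z).

(** The sign [(-1) ^ b] inside the group, with the group as its declared type
    so that products of signs are products in [Q] syntactically. *)
Definition zpow (b : 'F_2) : Q := (z ^+ b)%g.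

Lemma grM (x y : Q) : gr R (x * y)%g = gr R x * gr R y.
Proof.
apply/ffunP=> t; rewrite !ffunE (bigD1 x) //= big1 => [|y' /negPf ne].
  by rewrite !ffunE eqxx mul1r addr0 -[in RHS](inj_eq (mulgI x)) mulKVg.
by rewrite ffunE ne mul0r.
Qed.

Lemma iotaM (x y : Q) : iota (x * y)%g = iota x * iota y.
Proof. by rewrite /inQ grM -quot_mulE. Qed.

Lemma iota1 : iota 1%g = 1.
Proof. by []. Qed.

Lemma iota_z : iota z = -1.
Proof.
rewrite -[RHS](raddfN (to_quot (gr R z - -1))).
apply/to_quot_eq/two_sided_idealP; exists [:: (1, 1)].
by rewrite big_seq1 mul1r mulr1.
Qed.

Lemma scaler_mull (a : R) (p q : A) : a *: (p * q) = (a *: p) * q.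
Proof. exact: quot_scale_mull. Qed.

Lemma scaler_mulr (a : R) (p q : A) : a *: (p * q) = p * (a *: q).
Proof. exact: quot_scale_mulr. Qed.

Lemma scaler_sign (b : 'F_2) (y : Q) :
  (-1) ^+ b *: iota y = iota (zpow b * y)%g.
Proof.
case: (F2P b) => ->; first by rewrite expr0 scale1r mul1g.
by rewrite expr1 scaleN1r iotaM iota_z mulN1r.
Qed.

Hypotheses (z_central : forall y, commute z y) (z2 : (z ^+ 2 = 1)%g).

Lemma zpowD (a b : 'F_2) : (zpow (a + b) = zpow a * zpow b)%g.
Proof.
have [z0 z1] : zpow 0 = 1%g /\ zpow 1 = z by [].
by case: (F2P a) => ->; case: (F2P b) => ->;
  rewrite ?addF2 ?add0r ?addr0 ?z0 ?z1 ?mulg1 ?mul1g // -expg2 z2.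
Qed.

Lemma zpow_mulA a b y : (zpow a * (zpow b * y) = zpow (a + b) * y)%g.
Proof. by rewrite zpowD mulgA. Qed.

Lemma zpowC (a : 'F_2) y : (y * zpow a = zpow a * y)%g.
Proof. exact/commuteX/commute_sym. Qed.

Section Gauss.
Variable x : F2vec -> Q.
Hypothesis xD : forall u v, x (u + v) = (x u * x v)%g.

(** The Gauss sum of the quadratic form [qform], with the characters of
    [F_2^6] replaced by a homomorphism to [Q]; 8 is the square root of the
    number of terms. *)
Definition gauss : A := 8^-1 *: \sum_v iota (zpow (qform v) * x v)%g.

Lemma hom_shift u v : (x u * x (u + v) = x v)%g.
Proof.
by rewrite -xD addrA addF2vec add0r.
Qed.

(** Moving [y] through the sum multiplies its [v]-th term by [(-1) ^ bform u
    v]. As [qform v + bform u v = qform (u + v) + qform u], this only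
    translates the index of summation by [u]. *)
Lemma gauss_shift u y : (forall v, x v * y = y * x v * zpow (bform u v))%g ->
  gauss * iota y = iota (zpow (qform u) * y * x u)%g * gauss.
Proof.
move=> comm; rewrite /gauss -scaler_mull -scaler_mulr; congr (_ *: _).
rewrite mulr_suml mulr_sumr [RHS](reindex_inj (addrI u)) /=.
apply: eq_bigr => v _; rewrite -!iotaM; congr iota.
rewrite -mulgA comm zpowC mulgA -zpowD.
rewrite -[in RHS]mulgA [(x u * _)%g]mulgA zpowC -[(_ * x u * _)%g]mulgA hom_shift.
rewrite mulgA zpowC !mulgA -zpowD; congr (zpow _ * _ * _)%g.
by rewrite qformD [RHS]addrC !addrA addF2 add0r.
Qed.

(** Orthogonality of characters: if [bform u0 v = 1], translating by [u0]
    changes the sign of the sum. *)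
Lemma sum_sign_bform v :
  \sum_u iota (zpow (bform u v)) = 64%:R *+ (v == 0) :> A.
Proof.
have [->|nz] := eqVneq v 0.
  rewrite (eq_bigr (fun=> 1)) => [|u _].
    by rewrite sumr_const card_mx card_ord.
  have -> : bform u 0 = 0 by rewrite -(addF2 (bform u 0)) -bformDr addr0.
  by [].
have [u0 hu0] : exists u0, bform u0 v = 1.
  apply: contra_notP (elimN eqP nz) => /forallNP h; apply: bform_nondeg => u.
  by case: (F2P (bform u v)) (h u).
(* A sum equal to its opposite vanishes, as 2 is invertible in [R]. *)
set s := \sum_u _; suff ss : s = - s.
  have : 2%:R *: s = 0 :> A by rewrite scaler_nat mulr2n {1}ss addNr.
  move/(congr1 (fun t => 2^-1 *: t)); rewrite scalerA scaler0 mulVf ?scale1r //.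
  by rewrite pnatr_eq0.
rewrite /s -sumrN [LHS](reindex_inj (addrI u0)); apply: eq_bigr => u _.
by rewrite bformDl hu0 zpowD iotaM iota_z mulN1r.
Qed.

(** Collecting the terms of the square with the same product [x v], the
    coefficient of [x v] is a sign times the sum of [(-1) ^ bform u v] over
    all [u], which is [64] for [v = 0] and [0] otherwise. *)
Lemma gauss_sqr : gauss * gauss = 1.
Proof.
rewrite /gauss -scaler_mull -scaler_mulr scalerA mulr_suml.
have -> : \sum_u iota (zpow (qform u) * x u)%g *
    (\sum_v iota (zpow (qform v) * x v)%g) =
  \sum_v iota (zpow (qform v) * x v)%g * (64%:R *+ (v == 0)) :> A.
  (* Substitute [u + v] for the second index: [x u * x (u + v) = x v]. *)
  under eq_bigr => u _ do rewrite mulr_sumr (reindex_inj (addrI u)).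
  rewrite exchange_big; apply: eq_bigr => v _; rewrite -sum_sign_bform mulr_sumr.
  apply: eq_bigr => u _; rewrite -!iotaM; congr iota.
  rewrite -mulgA [(x u * _)%g]mulgA [(x u * zpow _)%g]zpowC.
  rewrite -[(_ * x u * _)%g]mulgA hom_shift [RHS]zpowC !mulgA -!zpowD; congr (zpow _ * _)%g.
  by rewrite qformD -[X in _ + X]addrA [LHS]addrA addF2 add0r addrC.
have x0 : x 0 = 1%g by apply: (mulgI (x 0)); rewrite -xD addr0 mulg1.
rewrite (bigD1 0) // big1 => [|v /negPf nz]; last by rewrite nz mulr0.
rewrite [X in _ *: X]addr0 eqxx qform0 x0 mulg1 iota1 mul1r.
(* The coefficient of 1 is [64 / (8 * 8)]. *)
rewrite -[_ *+ true]/(64%:R : A) -scaler_nat scalerA (natrM _ 8 8) mulrA.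
by rewrite mulfVK ?mulVf ?scale1r // pnatr_eq0.
Qed.

Lemma gauss_conj u y : (forall v, x v * y = y * x v * zpow (bform u v))%g ->
  gauss * iota y * gauss = iota (zpow (qform u) * y * x u)%g.
Proof. by move=> /gauss_shift ->; rewrite -mulrA gauss_sqr mulr1. Qed.

End Gauss.
End SignedGroupRing.

(** * The action of xi *)

Lemma big_param (T : finType) (A : nmodType) (f : F2vec -> T) (P : pred T) (F : T -> A) :
  injective f -> (forall t, reflect (exists u, t = f u) (P t)) ->
  \sum_(t | P t) F t = \sum_u F (f u).
Proof.
move=> f_inj PP; rewrite [RHS](_ : _ = \sum_(u in [set: F2vec]) F (f u)); last first.
  by apply: eq_bigl => u; rewrite inE.
rewrite -(big_imset F (h := f)) /=; last by move=> u v _ _; apply: f_inj.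
apply: eq_bigl => t; apply/PP/imsetP => [[u ->]|[u _ ->]]; exists u => //; by rewrite inE.
Qed.

Section Conjugation.
Variables (R : realType) (theta : golay -> golay -> 'F_2).
Hypothesis theta_cocycle : is_cocycle theta.
Variables (Qx : finGroupType) (xP : parker -> Qx) (xC : Cstar -> Qx).
Hypothesis Qx_presented : is_Qx theta xP xC.
Local Notation z := (xP pm1).
Local Notation iota := (inQ R z).
Local Notation xt := (xtilde theta xP xC).

Lemma meet0 w : meet (0 : golay) w = 0.
Proof. by apply/rowP=> i; rewrite !mxE mul0r. Qed.

Lemma wsize0 : wsize (0 : golay) = 0%N.
Proof. by apply: eq_card0 => i; rewrite !inE mxE. Qed.

Lemma pairing_thetaS d e : pairing e (thetaS theta d) = theta d e.
Proof.
rewrite /thetaS; case: pickP => [delta /forallP/(_ e)/eqP //|none].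
have [delta hdelta] := pairing_perfect (theta_Dr theta_cocycle d).
by move: (none delta) => /forallP[] f; rewrite hdelta.
Qed.

Lemma pairing_Amap d e f : pairing f (Amap d e) = Amap3 d e f.
Proof.
by rewrite pairing_cls /Amap3 wsizeE; apply: eq_bigr => i _; rewrite !mxE mulrC.
Qed.

(** The cocycle identity of [theta] in its first argument, read in [C^*]. *)
Lemma thetaSD d e : thetaS theta (d + e) = thetaS theta d + thetaS theta e + Amap d e.
Proof.
apply: pairing_inj => f; rewrite !pairingDr !pairing_thetaS pairing_Amap.
exact: (theta_Dl theta_cocycle).
Qed.

Lemma z_central y : commute z y.
Proof. by apply: (centP (Qx_central Qx_presented)); rewrite inE. Qed.

Lemma z2 : (z ^+ 2 = 1)%g.
Proof. by rewrite (Qx_P2 Qx_presented) /Pmap wsize0. Qed.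

(** Associativity stated in [Qx] itself: rewriting with the generic law leaves
    products over a structure that the lemmas on signs do not match. *)
Lemma mulQxA (a b c : Qx) : (a * (b * c) = a * b * c)%g.
Proof. exact: mulgA. Qed.

Local Notation zp := (zpow z).
Local Notation zpA := (zpow_mulA z2).
Local Notation zpC := (zpowC z_central).

Lemma xCD delta eps : xC (delta + eps) = (xC delta * xC eps)%g.
Proof. by rewrite (Qx_CD Qx_presented). Qed.

Lemma xC0 : xC 0 = 1%g.
Proof. by apply: (mulgI (xC 0)); rewrite -xCD addr0 mulg1. Qed.

Lemma thetaS0 : thetaS theta 0 = 0.
Proof. by have := thetaSD 0 0; rewrite /Amap meet0 cls0 !addr0 addCstar. Qed.

Lemma theta0l d : theta 0 d = 0.
Proof. by rewrite -pairing_thetaS thetaS0 pairing0r. Qed.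

Lemma xP_sign d l : xP (d, l) = (zp l * xP (d, 0%R))%g.
Proof.
have mul0 m : (xP (0, m) * xP (d, 0%R) = xP (d, m))%g.
  rewrite (Qx_PM Qx_presented) /pmul /Amap /= meet0 cls0 xC0 mulg1 theta0l.
  by rewrite add0r !addr0.
case: (F2P l) => ->; first by rewrite mul1g.
exact: (esym (mul0 1)).
Qed.

Lemma xCP delta d :
  (xC delta * xP d = zp (pairing d.1 delta) * (xP d * xC delta))%g.
Proof.
have -> : (xP d * xC delta = xC delta * xP d * zp (pairing d.1 delta))%g.
  by rewrite commgC (Qx_PC Qx_presented).
by rewrite zpC zpA addF2 mul1g.
Qed.

(** Correcting [x_d] by [x_theta(d)] makes it a homomorphism. Interchanging
    [x_theta(d)] and [x_e] produces the sign [theta d e], which cancels the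
    one in the Parker loop product, and [thetaSD] absorbs the factor [x_A(d,
    e)]. *)
Lemma xtD d e : xt (d + e) = (xt d * xt e)%g.
Proof.
rewrite /xtilde thetaSD !xCD.
have swap (a b c f : Qx) : (a * b * (c * f) = a * (b * c) * f)%g by rewrite !mulQxA.
rewrite swap xCP /= pairing_thetaS [RHS](_ : _ = zp (theta d e) *
    (xP (d, 0%R) * xP (e, 0%R) * (xC (thetaS theta d) * xC (thetaS theta e))))%g.
  rewrite (Qx_PM Qx_presented) /pmul /= !add0r (xP_sign _ (theta d e)) -!mulQxA zpA addF2 mul1g.
  by rewrite -!xCD addrA; congr (_ * xC _)%g; rewrite addrC.
by rewrite mulQxA zpC -!mulQxA.
Qed.

Lemma xt0 : xt 0 = 1%g.
Proof. by apply: (mulgI (xt 0)); rewrite -xtD addr0 mulg1. Qed.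

Lemma xCt delta d : (xC delta * xt d = zp (pairing d delta) * (xt d * xC delta))%g.
Proof.
rewrite /xtilde mulQxA xCP /= -!mulQxA; congr (_ * (_ * _))%g.
by rewrite -!xCD addrC.
Qed.

(** Thus [Qx] is a Heisenberg group over the pairing of [C] with [C^*], and
    this is its general element. *)
Definition normal_form (k : 'F_2) d delta : Qx := (zp k * (xt d * xC delta))%g.
Local Notation N := normal_form.

Lemma normal_form_mul k d delta k' d' delta' :
  (N k d delta * N k' d' delta' =
   N (k + k' + pairing d' delta) (d + d') (delta + delta'))%g.
Proof.
have swap (a b c f : Qx) : (a * b * (zp k' * (c * f)) = zp k' * (a * (b * c) * f))%g.
  by rewrite [LHS]mulQxA zpC -!mulQxA.
have pull (a b c f : Qx) g : (a * (zp g * (b * c)) * f = zp g * (a * b * (c * f)))%g.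
  by rewrite [(a * _)%g]mulQxA zpC -!mulQxA.
by rewrite /N -[LHS]mulQxA swap xCt pull xtD xCD !zpA.
Qed.

Lemma normal_form_t d : xt d = N 0 d 0.
Proof. by rewrite /N xC0 mulg1 [zp 0](_ : _ = 1%g) // mul1g. Qed.

Lemma normal_form_C delta : xC delta = N 0 0 delta.
Proof. by rewrite /N xt0 !mul1g. Qed.

Lemma normal_form_z k : zp k = N k 0 0.
Proof. by rewrite /N xt0 xC0 !mulg1. Qed.

Lemma xP_normal_form d l : xP (d, l) = N l d (thetaS theta d).
Proof. by rewrite xP_sign /N /xtilde -mulQxA -xCD addCstar xC0 mulg1. Qed.

Lemma normal_formP q : exists k d delta, q = N k d delta.
Proof.
pose T := [set q | `[< exists k d delta, q = N k d delta >]].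
have TP q' : reflect (exists k d delta, q' = N k d delta) (q' \in T).
  by rewrite inE; apply: asboolP.
have T_group : group_set T.
  apply/group_setP; split; first by apply/TP; exists 0, 0, 0; rewrite -normal_form_C xC0.
  move=> _ _ /TP[k [d [delta ->]]] /TP[k' [d' [delta' ->]]].
  by apply/TP; rewrite normal_form_mul; do 3!eexists.
apply/TP; have : q \in [set: Qx] by rewrite inE.
rewrite -(Qx_gen Qx_presented); apply/subsetP; rewrite (gen_subG _ (group T_group)).
apply/subsetP=> y /setUP[] /imsetP[].
  by move=> [d l] _ ->; apply/TP; exists l, d, (thetaS theta d); exact: xP_normal_form.
by move=> delta _ ->; apply/TP; exists 0, 0, delta; exact: normal_form_C.
Qed.

Local Notation Xg := (gauss R z (fun v => xt (greyvec v))).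
Local Notation Xgamma := (gauss R z (fun v => xC (greySvec v))).

Lemma xt_greyvecD u v : xt (greyvec (u + v)) = (xt (greyvec u) * xt (greyvec v))%g.
Proof. by rewrite greyvecD xtD. Qed.

Lemma xC_greySvecD u v :
  xC (greySvec (u + v)) = (xC (greySvec u) * xC (greySvec v))%g.
Proof. by rewrite greySvecD xCD. Qed.

Lemma xi_gammaE : xi_gamma R xP xC = Xgamma.
Proof.
rewrite /xi_gamma /gauss (big_param _ greySvec_inj greySP); congr (_ *: _).
by apply: eq_bigr => v _; rewrite w2GS_greySvec scaler_sign.
Qed.

Lemma xi_gE : xi_g R theta xP xC = Xg.
Proof.
rewrite /xi_g /gauss (big_param _ greyvec_inj greyP); congr (_ *: _).
by apply: eq_bigr => v _; rewrite w2G_greyvec scaler_sign.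
Qed.

(** The elements of [C^*] commute with [xi_gamma]; a codeword [d] acts on the
    grey classes through a functional, which [bform] represents by some [u],
    and it acquires the factor [x_u]. *)
Lemma xi_gamma_conj k d delta u : (forall v, pairing d (greySvec v) = bform u v) ->
  Xgamma * iota (N k d delta) * Xgamma = iota (N (k + qform u) d (delta + greySvec u)).
Proof.
move=> hu; rewrite (gauss_conj R z_central z2 xC_greySvecD (u := u)).
  rewrite normal_form_C normal_form_z !normal_form_mul pairing0r pairing0l.
  by rewrite !add0r !addr0 [k + _]addrC.
move=> v; rewrite normal_form_C normal_form_z !normal_form_mul hu.
rewrite !pairing0l !(add0r, addr0) addrC; congr (N _ _ _).
by rewrite addrC.
Qed.

(** The same with the two halves of the Heisenberg group exchanged. The new
    factor is moved past [delta] at the cost of the sign [bform w w = 0]. *)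
Lemma xi_g_conj k d delta w : (forall v, pairing (greyvec v) delta = bform w v) ->
  Xg * iota (N k d delta) * Xg = iota (N (k + qform w) (d + greyvec w) delta).
Proof.
move=> hw; rewrite (gauss_conj R z_central z2 xt_greyvecD (u := w)).
  rewrite normal_form_t normal_form_z !normal_form_mul !(add0r, addr0) hw.
  rewrite bform_alt pairing0r.
  by rewrite !(add0r, addr0) [k + _]addrC.
move=> v; rewrite normal_form_t normal_form_z !normal_form_mul !(add0r, addr0) hw.
rewrite !pairing0l !pairing0r !(add0r, addr0); congr (N _ _ _); last by rewrite addrC.
by rewrite -addrA addF2 addr0.
Qed.

Local Notation X := (xi R theta xP xC).
Local Notation X' := (Xg * Xgamma).

Lemma xiE : X = Xgamma * Xg.
Proof. by rewrite /xi xi_gammaE xi_gE. Qed.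

Lemma xi_gamma_sqr : Xgamma * Xgamma = 1.
Proof. exact: (gauss_sqr R z_central z2 xC_greySvecD). Qed.

Lemma xi_g_sqr : Xg * Xg = 1.
Proof. exact: (gauss_sqr R z_central z2 xt_greyvecD). Qed.

Lemma xi_invl : X' * X = 1.
Proof. by rewrite xiE -mulrA [Xgamma * _]mulrA xi_gamma_sqr mul1r xi_g_sqr. Qed.

Lemma xi_invr : X * X' = 1.
Proof. by rewrite xiE -mulrA [Xg * _]mulrA xi_g_sqr mul1r xi_gamma_sqr. Qed.

Lemma xi_conj_split y : X' * y * X = Xg * (Xgamma * y * Xgamma) * Xg.
Proof. by rewrite xiE !mulrA. Qed.

(** Every functional on [F_2^6] is represented by [bform], so the two
    conjugation lemmas apply in turn to any element of [Qx]. *)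
Lemma xi_normalises q : exists q', X' * iota q * X = iota q'.
Proof.
have [k [d [delta ->]]] := normal_formP q.
have [|u hu] := @bform_repr (fun v => pairing d (greySvec v)).
  by move=> v w; rewrite greySvecD pairingDr.
rewrite xi_conj_split (xi_gamma_conj k delta (u := u)) //.
have [|w hw] := @bform_repr (fun v => pairing (greyvec v) (delta + greySvec u)).
  by move=> v w; rewrite greyvecD pairingDl.
by rewrite (xi_g_conj _ _ (w := w)) //; eexists.
Qed.

(** The two involutions act in turn as [(u, v) |-> (u, u + v)] and [(u, v) |->
    (u + v, v)] on the grey coordinates. The signs add up to [qform u + qform
    (u + v) = qform v + bform u v]. *)
Lemma xi_conj k u v h eta :
  (forall v, pairing h (greySvec v) = 0) -> (forall v, pairing (greyvec v) eta = 0) ->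
  X' * iota (N k (greyvec u + h) (greySvec v + eta)) * X =
  iota (N (k + qform v + bform u v) (greyvec v + h) (greySvec (u + v) + eta)).
Proof.
move=> hS etaG; rewrite xi_conj_split (xi_gamma_conj k _ (u := u)); last first.
  by move=> w; rewrite pairingDl pairing_greyvec hS addr0.
rewrite addrAC -greySvecD [v + u]addrC (xi_g_conj _ _ (w := u + v)); last first.
  by move=> w; rewrite pairingDr pairing_greyvec etaG addr0 bformC.
rewrite [greyvec u + h + _]addrAC -greyvecD [u + (u + v)]addrA addF2vec.
congr (iota (N _ _ _)); last by rewrite add0r.
by rewrite qformD -!addrA [qform u + (_ + _)]addrA addF2 add0r.
Qed.

End Conjugation.

Theorem lemma9p5 (R : realType) (theta : golay -> golay -> 'F_2)
    (theta_cocycle : is_cocycle theta)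
    (Qx : finGroupType) (xP : parker -> Qx) (xC : Cstar -> Qx)
    (Qx_presented : is_Qx theta xP xC) :
  let z := xP pm1 in
  let iota : Qx -> RQpm R z := inQ R z in
  let xt := xtilde theta xP xC in
  let X := xi R theta xP xC in
  exists X' : RQpm R z, [/\ X' * X = 1, X * X' = 1,
    (forall q : Qx, exists q' : Qx, X' * iota q * X = iota q') &
    forall (d e : golay) (h : parker) (eta : Cstar),
      grey d -> grey e -> coloured h.1 -> colouredS eta ->
      let delta := gamma d in
      let eps := gamma e in
      [/\ X' * iota (xt d * xt h.1 * xC eps * xC eta)%g * X =
            iota (z ^+ (w2G e + gform d e)%R *
                  (xt e * xt h.1 * xC (delta + eps)%R * xC eta))%g,
          X' ^+ 2 * iota (xt d * xt h.1 * xC eps * xC eta)%g * X ^+ 2 =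
            iota (z ^+ (w2G d + gform d e)%R *
                  (xt (d + e)%R * xt h.1 * xC delta * xC eta))%g &
          X' * iota (xP h * xC (gamma h.1))%g * X =
            iota (xP h * xC (gamma h.1))%g]].
Proof.
move=> z iota xt X.
pose X' : RQpm R z :=
  gauss R z (fun v => xt (greyvec v)) * gauss R z (fun v => xC (greySvec v)).
pose N := normal_form theta xP xC.
have conj k u v h eta : (forall w, pairing h (greySvec w) = 0) ->
    (forall w, pairing (greyvec w) eta = 0) ->
    X' * iota (N k (greyvec u + h) (greySvec v + eta)) * X =
    iota (N (k + qform v + bform u v) (greyvec v + h) (greySvec (u + v) + eta)).
  exact: (xi_conj R theta_cocycle Qx_presented).
exists X'; split; [exact: xi_invl | exact: xi_invr | exact: xi_normalises |].
move=> _ _ h eta /greyP[u ->] /greyP[v ->] ch etaG delta eps.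
rewrite /gform /delta /eps !gamma_greyvec pairing_greyvec !w2G_greyvec.
have hS w : pairing h.1 (greySvec w) = 0.
  by rewrite pairing_greySvec big1 // => j _; rewrite coloured_row0 ?mulr0.
have etaG' w : pairing (greyvec w) eta = 0.
  by move/forallP/(_ (greyvec w))/implyP: etaG => /(_ (grey_greyvec w))/eqP.
have nf k d eps' : (z ^+ (k : 'F_2) * (xt d * xt h.1 * xC eps' * xC eta))%g =
    N k (d + h.1) (eps' + eta).
  rewrite /N /normal_form (xtD theta_cocycle Qx_presented) (xCD Qx_presented).
  by rewrite !mulgA.
have nf0 d eps' : (xt d * xt h.1 * xC eps' * xC eta)%g = N 0 (d + h.1) (eps' + eta).
  by rewrite -nf mul1g.
split.
- by rewrite nf0 conj // nf add0r -greySvecD.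
- rewrite nf0 nf [LHS](_ : _ = X' * (X' * iota (N 0 (greyvec u + h.1)
    (greySvec v + eta)) * X) * X); last by rewrite !expr2 !mulrA.
  (* The grey coordinates go [(u, v) -> (v, u + v) -> (u + v, u)]. *)
  rewrite !conj // -greyvecD add0r; congr (iota (N _ _ (greySvec _ + _))).
    rewrite qformD bformDr bform_alt addr0 (bformC v u).
    case: (F2P (qform u)) => ->; case: (F2P (qform v)) => ->;
    by case: (F2P (bform u v)) => ->; apply: val_inj.
  by rewrite addrCA addF2vec addr0.
(* Both [theta h] and [gamma h] restrict to the same functional on the grey
   words, so [x_h x_gamma(h)] has no grey part at all. *)
have etaG'' w : pairing (greyvec w) (thetaS theta h.1 + gamma h.1) = 0.
  rewrite pairingDr (pairing_thetaS theta_cocycle).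
  by rewrite (theta_hg theta_cocycle (grey_greyvec w) ch) addF2.
have -> : (xP h * xC (gamma h.1))%g =
    N h.2 (greyvec 0 + h.1) (greySvec 0 + (thetaS theta h.1 + gamma h.1)).
  rewrite {1}[h]surjective_pairing (xP_normal_form theta_cocycle Qx_presented).
  rewrite /greyvec /greySvec !(comb0, add0r); [|exact: addCstar|exact: addgolay].
  by rewrite /N /normal_form (xCD Qx_presented) !mulgA.
by rewrite conj // bform_alt qform0 !addr0.
Qed.
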